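(* If $G$ is a connected graph of maximum degree $3$, then $\chi'_c(G)\leq 4$.
   Context: All graphs are finite and simple. An ordering $e_1,\dots,e_m$ of the edges of $G$ is connected if for every $i\ge 2$ the edge $e_i$ shares an endpoint with some $e_j$, $j<i$. The greedy edge colouring following an ordering $e_1,\dots,e_m$ assigns, for $i=1,\dots,m$, to $e_i$ the smallest positive integer not already assigned to an edge $e_j$ ($j<i$) sharing an endpoint with $e_i$. The connected greedy chromatic index $\chi'_c(G)$ (defined for connected $G$) is the minimum, over all connected orderings of $E(G)$, of the number of colours used by the greedy edge colouring following that ordering. *)

(* Defs.v *)
From mathcomp Require Import all_boot.

Set Implicit Arguments.
Unset Strict Implicit.
Unset Printing Implicit Defensive.

Record sgraph := SGraph {
  vertex :> finType;
  adj : rel vertex;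
  adj_sym : symmetric adj;
  adj_irrefl : irreflexive adj }.

Section SimpleGraph.

Variable G : sgraph.

Definition edges : {set {set G}} :=
  [set [set p.1; p.2] | p in [set p : G * G | adj p.1 p.2]].

Definition degree (x : G) : nat := #|[set y | adj x y]|.

Definition max_degree : nat := \max_(x : G) degree x.

Definition connected_graph : bool :=
  (0 < #|G|) && [forall x : G, forall y : G, connect (@adj G) x y].

Definition share_endpoint (e f : {set G}) : bool := e :&: f != set0.

Definition connected_ordering (s : #|edges|.-tuple {set G}) : bool :=
  perm_eq s (enum edges) &&
  [forall i : 'I_#|edges|, (0 < i) ==>
     [exists j : 'I_#|edges|, (j < i) && share_endpoint (tnth s i) (tnth s j)]].

End SimpleGraph.

Lemma exists_free (used : seq nat) : exists c, (0 < c) && (c \notin used).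
Proof.
exists (sumn used).+1; rewrite /=; apply/negP => h.
suff : (sumn used).+1 <= sumn used by rewrite ltnn.
move: (sumn used).+1 h => c; elim: used => //= a s IH.
rewrite inE => /orP [/eqP -> | /IH h]; first exact: leq_addr.
exact: leq_trans h (leq_addl _ _).
Qed.

Definition smallest_free (used : seq nat) : nat := ex_minn (exists_free used).

Section Greedy.

Variable G : sgraph.

(* Partial colourings are lists of (edge, colour) pairs. *)
Definition greedy_step (col : seq ({set G} * nat)) (e : {set G}) :=
  rcons col
    (e, smallest_free [seq p.2 | p <- col & share_endpoint e p.1]).

Definition greedy_colouring (s : seq {set G}) : seq ({set G} * nat) :=
  foldl greedy_step [::] s.

Definition colours_used (s : seq {set G}) : nat :=
  size (undup [seq p.2 | p <- greedy_colouring s]).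

Definition greedy_value (k : nat) : bool :=
  [exists s : #|edges G|.-tuple {set G},
     connected_ordering s && (colours_used s == k)].

Lemma edges_adj (x y : G) : adj x y -> [set x; y] \in edges G.
Proof. by move=> h; apply/imsetP; exists (x, y); rewrite ?inE. Qed.

Lemma extend_ordering (s : seq {set G}) :
  connected_graph G -> uniq s -> {subset s <= edges G} -> size s < #|edges G| ->
  exists2 f, (f \in edges G) && (f \notin s) &
    (0 < size s -> exists2 g, g \in s & share_endpoint f g).
Proof.
move=> /andP [_ /forallP hC] us ss lt.
have [f fE fs] : exists2 f, f \in edges G & f \notin s.
  apply/subsetPn; apply: contraL lt => /subset_leq_card h.
  by rewrite -leqNgt (leq_trans h) // card_size.
case: s us ss lt fs => [|e s] us ss lt fs; first by exists f; rewrite ?fE.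
set t := e :: s in us ss lt fs *.
pose V := [set x : G | has (fun g : {set G} => x \in g) t].
have [/existsP [g /and3P [gE gt /set0Pn [x]]]|hN] :=
    boolP [exists g, [&& g \in edges G, g \notin t & g :&: V != set0]].
  rewrite !inE => /andP [xg /hasP [h ht xh]].
  exists g; first by rewrite gE.
  by move=> _; exists h => //; apply/set0Pn; exists x; rewrite inE xg.
have inV x (g : {set G}) : x \in V -> x \in g -> g \in edges G -> g \in t.
  move=> xV xg gE; apply: contraNT hN => gt; apply/existsP; exists g.
  by rewrite gE gt; apply/set0Pn; exists x; rewrite inE xg.
have cl : closed (@adj G) (mem V).
  apply: intro_closed; first by apply: sym_connect_sym; exact: adj_sym.
  move=> x y xy xV; rewrite inE; apply/hasP; exists [set x; y].
    by apply: (inV x) => //; rewrite ?edges_adj // !inE eqxx.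
  by rewrite !inE eqxx orbT.
have ne (g : {set G}) : g \in edges G -> exists x, x \in g.
  by case/imsetP=> p _ ->; exists p.1; rewrite !inE eqxx.
have et : e \in t by rewrite inE eqxx.
have [x xe] := ne _ (ss _ et); have [y yf] := ne _ fE.
have xV : x \in V by rewrite inE; apply/hasP; exists e.
have yV : y \in V.
  by rewrite -(closed_connect cl (x := x)) //; exact: (forallP (hC x)).
by move: fs; rewrite (inV y).
Qed.

Lemma exists_connected_ordering : connected_graph G -> exists k, greedy_value k.
Proof.
move=> hC.
have [s [us ss sz hs]] : exists s : seq {set G},
    [/\ uniq s, {subset s <= edges G}, size s = #|edges G| &
     forall i, 0 < i < size s ->
       exists2 j, j < i & share_endpoint (nth set0 s i) (nth set0 s j)].
  move: (leqnn #|edges G|); elim: {1 3}#|edges G| => [|k IH] hk.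
    by exists [::]; split=> // i; rewrite andbF.
  have [s [us ss sz hs]] := IH (ltnW hk).
  have [|f /andP [fE fs] hf] := extend_ordering hC us ss; first by rewrite sz.
  exists (rcons s f); split.
  - by rewrite rcons_uniq fs.
  - by move=> g; rewrite mem_rcons inE => /orP [/eqP ->|/ss].
  - by rewrite size_rcons sz.
  move=> i; rewrite size_rcons ltnS => /andP [i0 ile].
  move: ile; rewrite leq_eqVlt => /orP [/eqP ei|ilt].
    have [|g gs fg] := hf; first by rewrite -ei.
    have lg : index g s < size s by rewrite index_mem.
    exists (index g s); first by rewrite ei.
    by rewrite !nth_rcons ei ltnn eqxx lg nth_index.
  have [|j ji a] := hs i; first by rewrite i0.
  by exists j => //; rewrite !nth_rcons ilt (ltn_trans ji ilt).
have szb : size s == #|edges G| by rewrite sz.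
exists (colours_used s); apply/existsP; exists (Tuple szb).
rewrite eqxx andbT; apply/andP; split.
  apply: uniq_perm => //; first exact: enum_uniq.
  have sub : {subset s <= enum (edges G)} by move=> g /ss; rewrite mem_enum.
  by case: (uniq_min_size us sub (eq_leq (esym (etrans sz (cardE _))))).
apply/forallP => i; apply/implyP => i0.
have [|j ji a] := hs i; first by rewrite i0 sz ltn_ord.
apply/existsP; exists (Ordinal (ltn_trans ji (ltn_ord i))).
by rewrite ji !(tnth_nth set0).
Qed.

Definition connected_greedy_index (hG : connected_graph G) : nat :=
  ex_minn (exists_connected_ordering hG).

End Greedy.

(* Main.v *)
Require Import Defs.
From mathcomp Require Import all_boot.
From mathcomp Require Import zify.

Set Implicit Arguments.
Unset Strict Implicit.
Unset Printing Implicit Defensive.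

(** An edge can only receive colour 5 if its four neighbours are coloured before
    it with four distinct colours.  Hence, if the uncoloured edges are connected
    (in the line graph) and contain a target [t] that is known to stay safe, one
    colours them while keeping the rest connected to [t]: every edge but [t] is
    coloured before one of its neighbours.  The pieces cut off from [t] hang on a
    single coloured edge, which has at most two neighbours coloured before it and
    so has colour at most 3; they are treated by induction.

    A safe target is an edge with at most three neighbours, a bridge leading to
    an uncoloured piece or, in the remaining cubic bridgeless case, an edge of a
    cycle: there is an induced lollipop (a path starting at the root edge and
    ending in a cycle) whose complement is connected.  Coloured along the path,
    its edges alternate between the colours 1 and 2, so the edge closing the
    cycle sees two neighbours of the same colour and is a safe target for
    everything that is left.  If the root edge is itself on the cycle and has
    colour 3, an edge leaving the cycle next to the target is coloured earlier,
    so as to force colour 3 on one of the neighbours of the target. *)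

(** * Connected sets *)

(** Among the edges that may be coloured next, the one leaving the largest uncoloured piece around
    the target is taken. The pieces it cuts off then touch no earlier coloured edge, since an edge
    of theirs that did would have been a better choice. The induction for such pieces demands colour
    at most 3 on the edge they hang on, because this edge may be a neighbour of the next target,
    where a repeated colour has to be produced: colours 1 and 2 are matched by the alternation along
    the path, 3 by the detour, and 4 is not covered. The lollipop comes from an extremal choice:
    among the connected vertex sets containing the root and a cycle, one leaving the largest
    connected set outside is taken, and then a smallest such one. Minimality gives the shape and
    excludes chords; maximality makes the complement connected. Cycles are detected by comparing
    numbers of induced edges and vertices, so that none has to be exhibited. *)

Section Connectedness.

Variables (T : finType) (e : rel T).
Hypothesis e_sym : symmetric e.
Implicit Types (A B C : {set T}) (x y z : T).

Definition closed_in A B := forall x y, x \in B -> y \in A -> e x y -> y \in B.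

(** Stated through closed subsets instead of paths: connectedness is used by exhibiting a nonempty
    closed set. The empty set counts as connected. The notion serves for vertices under [adj] and
    for edges under [share_endpoint]. *)
Definition conn A :=
  forall B, B \subset A -> B != set0 -> closed_in A B -> B = A.

Definition component A x :=
  [set y in A | connect [rel a b | [&& a \in A, b \in A & e a b]] x y].

Lemma component_sub A x : component A x \subset A.
Proof. by apply/subsetP => y; rewrite inE => /andP []. Qed.

Lemma component_refl A x : x \in A -> x \in component A x.
Proof. by move=> xA; rewrite inE xA connect0. Qed.

Lemma component_closed A x : closed_in A (component A x).
Proof.
move=> y z; rewrite !inE => /andP [yA xy] zA yz; rewrite zA.
by apply: connect_trans xy (connect1 _); rewrite /= yA zA yz.
Qed.

Lemma component_closedC A x : closed_in A (A :\: component A x).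
Proof.
move=> y z; rewrite !in_setD => /andP [yC yA] zA yz; rewrite zA andbT.
by apply: contra yC => zC; apply: component_closed zC yA _; rewrite e_sym.
Qed.

Lemma closed_in_sub A B C : conn C -> C \subset A -> closed_in A B ->
  ~~ [disjoint B & C] -> C \subset B.
Proof.
move=> cC sCA clB; rewrite -setI_eq0 => n0.
rewrite -(cC (B :&: C)) ?subsetIl ?subsetIr // => x y.
rewrite !inE => /andP [xB xC] yC xy; rewrite yC andbT.
exact: clB xB (subsetP sCA _ yC) xy.
Qed.

Lemma conn_sub A B C x : conn C -> C \subset A -> closed_in A B ->
  x \in B -> x \in C -> C \subset B.
Proof.
move=> cC sCA clB xB xC; apply: closed_in_sub cC sCA clB _.
by apply/negP => /disjoint_setI0/setP/(_ x); rewrite !inE xB xC.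
Qed.

Lemma sub_component A C x : conn C -> C \subset A -> x \in C -> C \subset component A x.
Proof.
move=> cC sCA xC; apply: (conn_sub cC sCA (@component_closed A x)) (xC).
exact/component_refl/(subsetP sCA).
Qed.

Lemma component_conn A x : x \in A -> conn (component A x).
Proof.
move=> xA B sB /set0Pn [b bB] clB.
pose r := [rel a b | [&& a \in A, b \in A & e a b]].
have rsym : connect_sym r.
  by apply: sym_connect_sym => a c /=; rewrite e_sym andbCA.
have clr : closed r (mem B).
  apply: (intro_closed rsym) => a c /= /and3P [aA cA ac] aB.
  by apply: (clB _ _ aB) (ac); apply: (component_closed _ cA ac); apply: (subsetP sB).
apply/eqP; rewrite eqEsubset sB; apply/subsetP => y; rewrite inE => /andP [yA xy].
have := subsetP sB _ bB; rewrite inE => /andP [_ xb].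
suff: connect r b y by move/(closed_connect clr); rewrite bB => <-.
by apply: connect_trans xy; rewrite rsym.
Qed.

Lemma conn1 x : conn [set x].
Proof. by move=> B; rewrite subset1 => /orP [/eqP //|->]. Qed.

Lemma connU A B a b : conn A -> conn B -> a \in A -> b \in B -> e a b ->
  conn (A :|: B).
Proof.
move=> cA cB aA bB ab C sC /set0Pn [c cC] clC.
have sA : A \subset A :|: B := subsetUl _ _.
have sB : B \subset A :|: B := subsetUr _ _.
apply/eqP; rewrite eqEsubset sC subUset /=.
have : (A \subset C) || (B \subset C).
  have := subsetP sC _ cC; rewrite inE => /orP [cA'|cB'].
    by rewrite (conn_sub cA sA clC cC).
  by rewrite (conn_sub cB sB clC cC) // orbT.
case/orP => h; rewrite h ?andbT /=.
  apply: (conn_sub cB sB clC _ bB).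
  by apply: clC ab; [apply: (subsetP h)|apply: (subsetP sB)].
apply: (conn_sub cA sA clC _ aA).
by apply: (clC b); [apply: (subsetP h)|apply: (subsetP sA)|rewrite e_sym].
Qed.

Lemma connU1 A a b : conn A -> a \in A -> e a b -> conn (b |: A).
Proof.
by move=> cA aA ab; rewrite setUC; apply: connU cA (@conn1 b) aA (set11 b) ab.
Qed.

Lemma conn_crossing A B : conn A -> B \subset A -> B != set0 -> B != A ->
  exists x y, [/\ x \in B, y \in A :\: B & e x y].
Proof.
move=> cA sB n0 nA.
have [/existsP [x /existsP [y /and3P [? ? ?]]]|h] :=
  boolP [exists x, exists y, [&& x \in B, y \in A :\: B & e x y]].
  by exists x, y.
case/eqP: nA; apply: cA => // x y xB yA xy; apply: contraNT h => yB.
by apply/existsP; exists x; apply/existsP; exists y; rewrite inE xB yA yB.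
Qed.

Lemma conn_nbr A x y : conn A -> x \in A -> y \in A -> x != y ->
  exists2 z, z \in A :\ x & e x z.
Proof.
move=> cA xA yA xy.
have [|||u [v [/set1P -> h uv]]] := conn_crossing cA (B := [set x]).
- by rewrite sub1set.
- by apply/set0Pn; exists x; rewrite inE.
- by apply: contraNneq xy => h; rewrite -h !inE eq_sym in yA.
by exists v.
Qed.

(** Every other component of [A :\ a] stays attached to [a]. A closed [B] containing [a] becomes
    closed in [A] once the deleted component is added; a nonempty closed [B] avoiding [a] would
    already be closed in [A], hence contain [a]. *)
Lemma conn_setD_component A a x : conn A -> a \in A -> conn (A :\: component (A :\ a) x).
Proof.
set Q := component _ _ => cA aA B sB n0 clB.
have QA : Q \subset A by apply: subset_trans (component_sub _ _) (subD1set _ _).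
have aQ : a \notin Q by apply/negP => /(subsetP (component_sub _ _)); rewrite !inE eqxx.
have QB : [disjoint Q & B].
  by rewrite disjoint_sym; apply: disjointWl sB _;
    rewrite disjoint_sym -setI_eq0 setIDA setDIl setDv set0I.
have [aB|aB] := boolP (a \in B).
  suff <- : B :|: Q = A.
    by rewrite setDUl setDv setU0; apply/esym/setDidPl; rewrite disjoint_sym.
  apply: cA.
  - by rewrite subUset QA (subset_trans sB) ?subsetDl.
  - by apply/set0Pn; exists a; rewrite inE aB.
  move=> y z; rewrite !in_setU => h zA yz.
  have [//|zQ] := boolP (z \in Q); first by rewrite orbT.
  rewrite orbF; case/orP: h => [yB|yQ].
    by apply: clB yB _ yz; rewrite inE zQ.
  have [->//|za] := eqVneq z a.
  by case/negP: zQ; apply: component_closed yQ _ yz; rewrite !inE za.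
have BA : B = A.
  apply: cA n0 _; first exact: subset_trans sB (subsetDl _ _).
  move=> y z yB zA yz; apply: (clB y) => //; rewrite inE zA andbT.
  apply/negP => zQ; have: y \in Q.
    apply: (component_closed zQ); last by rewrite e_sym.
    rewrite !inE (subsetP (subset_trans sB (subsetDl _ _)) _ yB) andbT.
    by apply: contraNneq aB => <-.
  by move=> yQ; rewrite (disjointFr QB yQ) in yB.
by rewrite BA aA in aB.
Qed.

End Connectedness.

(** * Greedy colourings *)

Lemma smallest_free_gt0 l : 0 < smallest_free l.
Proof. by rewrite /smallest_free; case: ex_minnP => c /andP []. Qed.

Lemma smallest_free_notin l : smallest_free l \notin l.
Proof. by rewrite /smallest_free; case: ex_minnP => c /andP []. Qed.

Lemma smallest_free_min l c : 0 < c -> c \notin l -> smallest_free l <= c.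
Proof. by move=> c0 cl; rewrite /smallest_free; case: ex_minnP => m _; apply;
  rewrite c0. Qed.

(** Pigeonhole: if the smallest free colour exceeded [k], all of 1, ..., [k] would occur in [l]. *)
Lemma smallest_free_le l k : size (undup l) < k -> smallest_free l <= k.
Proof.
move=> lk; rewrite leqNgt; apply/negP => kl.
suff /uniq_leq_size : {subset iota 1 k <= undup l}.
  by rewrite iota_uniq size_iota => /(_ isT); rewrite leqNgt lk.
move=> c; rewrite mem_iota mem_undup => /andP [c0]; rewrite add1n ltnS => ck.
apply/negPn/negP => /(smallest_free_min c0) h.
by move: (leq_trans kl (leq_trans h ck)); rewrite ltnn.
Qed.

Section Greedy.

Variable G : sgraph.
Implicit Types (s u : seq {set G}) (e f g h : {set G}) (x y : G).

Lemma share_sym : symmetric (@share_endpoint G).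
Proof. by move=> e f; rewrite /share_endpoint setIC. Qed.

Lemma shareI x e f : x \in e -> x \in f -> share_endpoint e f.
Proof. by move=> xe xf; apply/set0Pn; exists x; rewrite inE xe. Qed.

Lemma shareP e f : reflect (exists2 x, x \in e & x \in f) (share_endpoint e f).
Proof.
apply: (iffP (set0Pn _)) => [[x]|[x xe xf]]; last by exists x; rewrite inE xe.
by rewrite inE => /andP [xe xf]; exists x.
Qed.

Lemma edgesP e :
  reflect (exists x y, adj x y /\ e = [set x; y]) (e \in edges G).
Proof.
apply: (iffP imsetP) => [[[x y]]|[x [y [xy ->]]]].
  by rewrite inE /= => xy ->; exists x, y.
by exists (x, y); rewrite ?inE.
Qed.

Lemma adj_neq x y : adj x y -> x != y.
Proof. by apply: contraTneq => ->; rewrite adj_irrefl. Qed.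

Lemma edges_at x e : e \in edges G -> x \in e -> exists2 y, adj x y & e = [set x; y].
Proof.
case/edgesP => a [b [ab ->]]; rewrite !inE => /orP [] /eqP ->; first by exists b.
by exists a; rewrite 1?setUC // adj_sym.
Qed.

Lemma edge_eq_set2 e x y :
  e \in edges G -> x \in e -> y \in e -> x != y -> e = [set x; y] /\ adj x y.
Proof.
move=> eE xe; have [z xz ->] := edges_at eE xe.
by rewrite !inE => /orP [/eqP->|/eqP ->] //; rewrite eqxx.
Qed.

Definition star x : {set {set G}} := [set e in edges G | x \in e].
Definition nbr e : {set {set G}} :=
  [set f in edges G | (f != e) && share_endpoint e f].

Lemma card_star x : #|star x| = degree x.
Proof.
have -> : star x = [set [set x; y] | y in [set y | adj x y]].
  apply/setP => e; rewrite inE; apply/andP/imsetP => [[eE xe]|[y]].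
    by have [y xy ->] := edges_at eE xe; exists y; rewrite ?inE.
  by rewrite inE => xy ->; rewrite edges_adj // !inE eqxx.
apply: card_in_imset => y z; rewrite !inE => xy xz /setP /(_ y).
by rewrite !inE eqxx orbT eq_sym (negPf (adj_neq xy)) => /esym /eqP.
Qed.

Lemma nbr_sub_star x y :
  nbr [set x; y] \subset (star x :\ [set x; y]) :|: (star y :\ [set x; y]).
Proof.
apply/subsetP => f; rewrite !inE => /and3P [fE fn /shareP [z]].
by rewrite !inE => /orP [] /eqP -> zf; rewrite fn fE zf ?orbT.
Qed.

Lemma card_nbr x y : adj x y ->
  #|nbr [set x; y]| <= (degree x).-1 + (degree y).-1.
Proof.
move=> xy; apply: leq_trans (subset_leq_card (nbr_sub_star x y)) _.
rewrite (leq_trans (leq_card_setU _ _)) // leq_add // -card_star.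
  by rewrite [#|star x|](cardsD1 [set x; y]) inE edges_adj // !inE eqxx.
by rewrite [#|star y|](cardsD1 [set x; y]) inE edges_adj // !inE eqxx orbT.
Qed.

Lemma nbrP e f : reflect [/\ f \in edges G, f != e & share_endpoint e f] (f \in nbr e).
Proof. by rewrite inE; apply: and3P. Qed.

(** The default 0, returned outside [s], is never a colour. *)
Definition col s g := nth 0 [seq p.2 | p <- greedy_colouring s] (index g s).

Definition ncol s e := smallest_free [seq col s g | g <- s & share_endpoint e g].

Lemma greedy_colouring_rcons s e :
  greedy_colouring (rcons s e) = greedy_step (greedy_colouring s) e.
Proof. by rewrite /greedy_colouring foldl_rcons. Qed.

Lemma greedy_colouring1 s : [seq p.1 | p <- greedy_colouring s] = s.
Proof.
elim/last_ind: s => [|s e IH] //.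
by rewrite greedy_colouring_rcons /greedy_step map_rcons IH.
Qed.

Lemma size_greedy_colouring s : size (greedy_colouring s) = size s.
Proof. by rewrite -(size_map fst) greedy_colouring1. Qed.

Lemma col_rcons s e g : g \in s -> col (rcons s e) g = col s g.
Proof.
move=> gs; rewrite /col greedy_colouring_rcons map_rcons nth_rcons size_map.
by rewrite size_greedy_colouring -cats1 index_cat gs index_mem gs.
Qed.

Lemma greedy_colouringE s : uniq s ->
  greedy_colouring s = [seq (g, col s g) | g <- s].
Proof.
move=> us; have szE := size_greedy_colouring s.
apply: (@eq_from_nth _ (set0, 0)); rewrite ?size_map // => i lt.
have lt' : i < size s by rewrite -szE.
rewrite (nth_map set0) // /col index_uniq // (nth_map (set0, 0)) //.
have := congr1 (fun l => nth set0 l i) (greedy_colouring1 s).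
by rewrite (nth_map (set0, 0)) //; case: nth => a b /= ->.
Qed.

Lemma ncolE s e : uniq s ->
  ncol s e = smallest_free [seq p.2 | p <- greedy_colouring s & share_endpoint e p.1].
Proof.
move=> us; rewrite /ncol greedy_colouringE // filter_map -map_comp.
by congr smallest_free; apply: eq_map.
Qed.

Lemma col_rcons_new s e : uniq s -> e \notin s -> col (rcons s e) e = ncol s e.
Proof.
move=> us es; rewrite /col greedy_colouring_rcons map_rcons nth_rcons size_map.
rewrite size_greedy_colouring -cats1 index_cat (negPf es) /= eqxx addn0 ltnn eqxx.
by rewrite ncolE.
Qed.

Definition startable s e := nilp s || has (share_endpoint e) s.

(** Prefixes of connected orderings whose colours stay within 4. Since they grow at the end, colours
    already given never change and each extension only requires a bound for the next edge. *)
Inductive greedy_ok : seq {set G} -> Prop :=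
| greedy_ok_nil : greedy_ok [::]
| greedy_ok_rcons s e : greedy_ok s -> e \in edges G -> e \notin s -> startable s e ->
    ncol s e <= 4 -> greedy_ok (rcons s e).

Lemma greedy_ok_uniq s : greedy_ok s -> uniq s.
Proof. by elim=> // {}s e _ us _ es _ _; rewrite rcons_uniq es. Qed.

Lemma greedy_ok_edges s : greedy_ok s -> {subset s <= edges G}.
Proof.
by elim=> // {}s e _ ss eE _ _ _ f; rewrite mem_rcons inE => /orP [/eqP ->|/ss].
Qed.

Lemma col_cat s u g : g \in s -> col (s ++ u) g = col s g.
Proof.
move=> gs; elim/last_ind: u => [|u e IH]; rewrite ?cats0 // -rcons_cat.
by rewrite col_rcons ?mem_cat ?gs.
Qed.

Lemma greedy_ok_col s e : greedy_ok s -> e \in s -> 0 < col s e <= 4.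
Proof.
move=> os; elim: os e => // {}s e os IH eE es st nc f.
rewrite mem_rcons inE; have [->|fe] := eqVneq f e => /= [_|fs].
  by rewrite col_rcons_new ?(greedy_ok_uniq os) // nc smallest_free_gt0.
by rewrite col_rcons // IH.
Qed.

Lemma ncol_neq s e f : f \in s -> share_endpoint e f -> ncol s e != col s f.
Proof.
move=> fs ef.
apply: contraNneq (smallest_free_notin [seq col s g | g <- s & share_endpoint e g]).
by rewrite -/(ncol s e) => ->; apply: map_f; rewrite mem_filter ef.
Qed.

Lemma col_proper s e f : greedy_ok s -> e \in s -> f \in s -> e != f ->
  share_endpoint e f -> col s e != col s f.
Proof.
move=> os; elim: os e f => // {}s e os IH eE es _ _ f g.
have new h : h \in s -> share_endpoint e h -> col (rcons s e) e != col (rcons s e) h.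
  move=> hs eh; rewrite col_rcons_new ?(greedy_ok_uniq os) // col_rcons //.
  exact: ncol_neq.
rewrite !mem_rcons !inE; have [->|fe] := eqVneq f e; have [->|ge] := eqVneq g e.
- by rewrite eqxx.
- by move=> _ gs _; apply: new.
- by move=> /= fs _ _; rewrite share_sym eq_sym; apply: new.
by move=> /= fs gs fg sh; rewrite !col_rcons //; apply: IH.
Qed.

Lemma ncol_le_card s e (A : {set {set G}}) : uniq s ->
  (forall g, g \in s -> share_endpoint e g -> g \in A) -> ncol s e <= #|A|.+1.
Proof.
move=> us sA; apply: smallest_free_le; rewrite ltnS.
rewrite (leq_trans (size_undup _)) // size_map cardE.
apply: uniq_leq_size; first exact: filter_uniq.
by move=> g; rewrite mem_filter mem_enum => /andP [eg gs]; apply: sA.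
Qed.

(** Two neighbours of equal colour leave fewer than [#|nbr e|] distinct colours around [e]. With at
    most four neighbours, this makes the closing edge of a lollipop safe. *)
Lemma ncol_le_same s e f g : greedy_ok s -> e \notin s -> f \in s -> g \in s -> f != g ->
  share_endpoint e f -> share_endpoint e g -> col s f = col s g ->
  ncol s e <= #|nbr e|.
Proof.
move=> os es fs gs fg ef eg cfg; apply: smallest_free_le.
have gN : g \in nbr e.
  by apply/nbrP; split=> //; [apply: greedy_ok_edges gs|apply: contraNneq es => <-].
rewrite [X in _ < X](cardsD1 g) gN add1n ltnS cardE -(size_map (col s)).
apply: uniq_leq_size => [|c]; first exact: undup_uniq.
rewrite mem_undup => /mapP [h]; rewrite mem_filter => /andP [eh hs] ->.
have [->|hg] := eqVneq h g.
  rewrite -cfg; apply: map_f; rewrite mem_enum !inE fg (greedy_ok_edges os fs) ef andbT.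
  by apply: contraNneq es => <-.
apply: map_f; rewrite mem_enum !inE hg (greedy_ok_edges os hs) eh andbT.
by apply: contraNneq es => <-.
Qed.

(** The colour of [e] was fixed by its earlier neighbours, which are among its neighbours in the
    whole of [s]. *)
Lemma col_le_card s e (A : {set {set G}}) : greedy_ok s -> e \in s ->
  (forall g, g \in s -> g != e -> share_endpoint e g -> g \in A) ->
  col s e <= #|A|.+1.
Proof.
move=> os; elim: os => // {}s f os IH fE fs _ _.
rewrite mem_rcons inE; have [-> _|ef /= es] := eqVneq e f => sA.
  rewrite col_rcons_new ?(greedy_ok_uniq os) //;
    apply: ncol_le_card (greedy_ok_uniq os) _.
  move=> g gs; apply: sA; first by rewrite mem_rcons inE gs orbT.
  by apply: contraNneq fs => <-.
rewrite col_rcons //; apply: IH => // g gs; apply: sA.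
by rewrite mem_rcons inE gs orbT.
Qed.

Lemma greedy_ok_colours_used s : greedy_ok s -> colours_used s <= 4.
Proof.
move=> os; rewrite /colours_used -[X in _ <= X](size_iota 1 4).
apply: uniq_leq_size; first exact: undup_uniq.
move=> c; rewrite mem_undup greedy_colouringE ?(greedy_ok_uniq os) // -map_comp.
by case/mapP=> g gs ->; rewrite mem_iota greedy_ok_col.
Qed.

Lemma greedy_ok_connected s i : greedy_ok s -> 0 < i < size s ->
  exists2 j, j < i & share_endpoint (nth set0 s i) (nth set0 s j).
Proof.
move=> os; elim: os i => [|{}s e os IH eE es st _] i; first by rewrite andbF.
rewrite size_rcons ltnS => /andP [i0]; rewrite leq_eqVlt => /orP [/eqP iE|ilt].
  have /hasP [g gs eg] : has (share_endpoint e) s.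
    by case/orP: st => //; rewrite /nilp -iE; case: i i0 {iE}.
  have lt : index g s < i by rewrite iE index_mem.
  by exists (index g s) => //; rewrite !nth_rcons iE ltnn eqxx -iE lt nth_index.
have [|j ji sh] := IH i; first by rewrite i0.
by exists j => //; rewrite !nth_rcons ilt (ltn_trans ji ilt).
Qed.

Lemma greedy_ok_connected_greedy_index s (hG : connected_graph G) : greedy_ok s -> s =i edges G ->
  connected_greedy_index hG <= 4.
Proof.
move=> os sE; rewrite /connected_greedy_index; case: ex_minnP => m _ min_m.
apply: leq_trans (greedy_ok_colours_used os); apply: min_m.
have sz : size s == #|edges G|.
  by rewrite -(card_uniqP (greedy_ok_uniq os)) (eq_card sE).
apply/existsP; exists (Tuple sz); rewrite eqxx andbT; apply/andP; split.
  apply: uniq_perm; rewrite ?enum_uniq ?(greedy_ok_uniq os) // => g.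
  by rewrite mem_enum sE.
apply/forallP => i; apply/implyP => i0.
have [|j ji a] := greedy_ok_connected (i := i) os; first by rewrite i0 (eqP sz) ltn_ord.
apply/existsP; exists (Ordinal (ltn_trans ji (ltn_ord i))).
by rewrite ji !(tnth_nth set0).
Qed.

End Greedy.

(** * Extending a greedy colouring towards a safe target *)

Section Extension.

Variable G : sgraph.
Hypothesis subcubic : forall x : G, degree x <= 3.
Implicit Types (s u : seq {set G}) (e f g h t : {set G}) (x y z : G).
Implicit Types (R D Q : {set {set G}}).

Notation share := (@share_endpoint G).

Lemma card_nbr_le4 e : e \in edges G -> #|nbr e| <= 4.
Proof.
case/edgesP => x [y [xy ->]]; apply: leq_trans (card_nbr xy) _.
have d z : (degree z).-1 <= 2 by case: degree (subcubic z).
exact: leq_add (d x) (d y).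
Qed.

(** Of at most four neighbours one is still uncoloured, so at most three colours are blocked. *)
Lemma ncol_le_missing s e g : greedy_ok s -> e \in edges G -> e \notin s ->
  g \in nbr e -> g \notin s -> ncol s e <= 4.
Proof.
move=> os eE es gN gs; apply: leq_trans (card_nbr_le4 eE).
rewrite (cardsD1 g) gN add1n; apply: ncol_le_card (greedy_ok_uniq os) _ => h hs eh.
rewrite !inE (greedy_ok_edges os hs) eh !andbT.
by apply/andP; split; apply: contraTneq hs => ->.
Qed.

(** All coloured neighbours of [e] sit at [y], which carries at most two edges besides [e]. *)
Lemma col_le3 s e y : greedy_ok s -> e \in s -> y \in e ->
  (forall g, g \in s -> share e g -> y \in g) -> col s e <= 3.
Proof.
move=> os es ye h; apply: leq_trans (_ : #|star y :\ e|.+1 <= 3).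
  apply: col_le_card => // g gs ge eg.
  by rewrite !inE ge (greedy_ok_edges os gs) h.
apply: leq_trans (subcubic y); rewrite -card_star (cardsD1 e (star y)).
by rewrite inE (greedy_ok_edges os es) ye.
Qed.

(* [R] touches the coloured edges only in [f], at the endpoint of [f] other than
   [x0]. *)
Definition hanging_extension n := forall s R f x0,
  #|R| <= n -> greedy_ok s -> R \subset edges G -> {in R, forall e, e \notin s} ->
  f \in s -> col s f <= 3 -> x0 \in f -> {in R, forall e, x0 \notin e} ->
  {in R, forall e, nbr e \subset f |: R} ->
  {in R, forall e, exists2 g, g \in component share R e & share g f} ->
  exists2 u : seq {set G}, u =i R & greedy_ok (s ++ u).

(** Treats the pieces [D] cut off when [e] is coloured. The endpoint [v] where [e] meets a coloured
    edge carries no edge of [D], as such an edge would be startable; so [D] hangs at the other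
    endpoint [w]. For the same reason no edge of [s] reaches [w], hence [e] has colour at most 3. *)
Lemma extend_side n s e D : hanging_extension n -> #|D| <= n ->
  greedy_ok s -> e \in edges G -> e \notin s -> startable s e -> ncol s e <= 4 ->
  e \notin D -> D \subset edges G -> {in D, forall g, g \notin s} ->
  {in D, forall g, ~~ startable s g} ->
  {in D, forall g, nbr g \subset e |: D} ->
  {in D, forall g, exists2 h, h \in component share D g & share h e} ->
  exists2 u : seq {set G}, u =i D & greedy_ok (rcons s e ++ u).
Proof.
move=> HF Dn os eE es st nc eD DE Ds nst DN Dc.
have oe : greedy_ok (rcons s e) by apply: greedy_ok_rcons.
have [->|/set0Pn [d dD]] := eqVneq D set0.
  by exists [::]; rewrite ?cats0 // => g; rewrite in_set0.
(* With [s] empty every edge is startable, so a nonempty [D] forces [s] to be nonempty. *)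
have /hasP [b bs /shareP [v ve vb]] : has (share e) s.
  by case/orP: st => // nl; move: (nst _ dD); rewrite /startable nl.
have nosh g h : g \in D -> h \in s -> share g h -> False.
  by move=> /nst + hs gh; case/negP; apply/orP; right; apply/hasP; exists h.
have vD : {in D, forall g, v \notin g}.
  by move=> g gD; apply/negP => vg; apply: (nosh g b) => //; apply: shareI vg vb.
have [w vw eE'] := edges_at eE ve.
have e2 z : z \in e -> z = v \/ z = w by rewrite eE' => /set2P.
have [g gD /shareP [z zg /e2 zE]] := Dc _ dD.
have {}gD : g \in D by apply: (subsetP (component_sub share _ _) _ gD).
case: zE => zE; subst z; first by rewrite (negPf (vD _ gD)) in zg.
apply: (HF _ _ e v) => //.
- move=> h hD; rewrite mem_rcons inE negb_or Ds // andbT.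
  by apply: contraNneq eD => <-.
- by rewrite mem_rcons inE eqxx.
apply: (col_le3 oe _ ve); first by rewrite mem_rcons inE eqxx.
move=> h; rewrite mem_rcons inE => /orP [/eqP -> //|hs] /shareP [z].
case/e2 => -> // wh.
by case: (nosh g h) => //; apply: shareI zg wh.
Qed.

(** An edge other than [t] is either coloured while a neighbour in the component of [t] is
    uncoloured, or lies in a piece left to [hanging_extension]. The hypothesis on [ncol (s ++ u) t]
    covers [t] whatever has been coloured before it. *)
Lemma extend_to_target n s R t : hanging_extension n -> #|R| <= n.+1 ->
  greedy_ok s -> R \subset edges G -> {in R, forall e, e \notin s} ->
  conn share R -> t \in R -> (exists2 e, e \in R & startable s e) ->
  {in R, forall e, e != t -> {subset nbr e <= [predU R & s]}} ->
  (forall u, {subset u <= R :\ t} -> greedy_ok (s ++ u) -> ncol (s ++ u) t <= 4) ->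
  exists2 u : seq {set G}, u =i R & greedy_ok (s ++ u).
Proof.
move=> HF; have [m] := ubnP #|R|; elim: m s R => // m IH s R.
rewrite ltnS => Rm Rn os RE Rs cR tR [e0 e0R st0] RN Ht.
have ReE e : e \in R -> e \in edges G by apply: (subsetP RE).
have shN e g : e \in R -> g \in R -> g != e -> share e g -> g \in nbr e.
  by move=> eR gR ge eg; apply/nbrP; split=> //; apply: ReE.
pose P e := (e \in R :\ t) && startable s e.
(* If only [t] can come next, it is coloured now and everything else hangs on it. *)
have [/existsP [e1 Pe1]|noP] := boolP [exists e, P e]; last first.
  have e0t : e0 = t.
    apply/eqP; apply: contraNT noP => ne; apply/existsP; exists e0.
    by rewrite /P !inE ne e0R.
  rewrite e0t in st0 e0R.
  have nst : {in R :\ t, forall g, ~~ startable s g}.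
    by move=> g gR; apply: contraNN noP => sg; apply/existsP; exists g; apply/andP.
  have nct : ncol s t <= 4 by rewrite -[s]cats0; apply: Ht; rewrite ?cats0.
  have [|||||||u uE ou] := extend_side (D := R :\ t) HF _ os (ReE _ tR) (Rs _ tR) st0 nct.
  - by move: Rn; rewrite (cardsD1 t) tR.
  - by rewrite !inE eqxx.
  - exact: subset_trans (subD1set _ _) RE.
  - by move=> g; rewrite inE => /andP [_ /Rs].
  - by [].
  - move=> g gR; have := gR; rewrite !inE => /andP [gt gRR].
    apply/subsetP => h hN; rewrite !inE; case: eqVneq => //= ht.
    case/orP: (RN _ gRR gt _ hN) => // hs; case/negP: (nst _ gR).
    by apply/orP; right; apply/hasP; exists h => //; case/nbrP: hN.
  - move=> g; rewrite !inE => /andP [gt gR].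
    set Q := component _ _ _.
    have gQ : g \in Q by apply: component_refl; rewrite !inE gt.
    have QR : Q \subset R by apply: subset_trans (component_sub _ _ _) (subD1set _ _).
    have [||x [y [xQ]]] := conn_crossing cR QR.
    + by apply/set0Pn; exists g.
    + apply: contraTneq tR => <-; apply/negP => /(subsetP (component_sub _ _ _)).
      by rewrite !inE eqxx.
    rewrite in_setD => /andP [yQ yR] xy; exists x => //.
    have [<- //|yt] := eqVneq y t; case/negP: yQ.
    by apply: component_closed xQ _ xy; rewrite !inE yt.
  exists (t :: u); last by rewrite -cat_rcons.
  by move=> g; rewrite inE uE !inE; case: eqVneq => // ->.
case: (arg_maxnP (fun e => #|component share (R :\ e) t|) Pe1).
move=> e /andP [eRt st] emax {e1 Pe1}.
have [et eR] : e != t /\ e \in R by move: eRt; rewrite !inE => /andP.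
set Rt := component share (R :\ e) t.
have tRe : t \in R :\ e by rewrite !inE eq_sym et.
have tRt : t \in Rt by apply: component_refl.
have RtR : Rt \subset R :\ e by apply: component_sub.
have eRt' : e \notin Rt by apply/negP => /(subsetP RtR); rewrite !inE eqxx.
have cRt : conn share Rt by apply: component_conn => //; apply: share_sym.
have [x [y [xRt yR xy]]] : exists x y : {set G}, [/\ x \in Rt, y \in R :\: Rt & share x y].
  apply: conn_crossing => //.
  - exact: subset_trans RtR (subD1set _ _).
  - by apply/set0Pn; exists t.
  by apply: contraTneq eR => <-.
have yE : y = e.
  apply/eqP; apply: contraTT yR => ye; rewrite inE negb_and negbK.
  have [yR|//] := boolP (y \in R); last by rewrite orbT.
  by rewrite (component_closed xRt _ xy) // !inE ye.
rewrite yE in xy; clear y yR yE.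
pose D := (R :\ e) :\: Rt.
have DR g : g \in D -> [/\ g \in R, g != e & g \notin Rt].
  by rewrite !in_setD in_set1 => /and3P [].
(* A startable [g] in [D], coloured instead of [e], would leave both [Rt] and [e] in the component
   of [t], against the choice of [e]. *)
have nst : {in D, forall g, ~~ startable s g}.
  move=> g gD; have [gR ge gRt] := DR _ gD; apply/negP => sg.
  have gt : g != t by apply: contraNneq gRt => ->.
  have := emax g; rewrite /P !inE gt gR sg => /(_ isT);
    rewrite /geq /= leqNgt => /negP [].
  rewrite -/Rt; apply: (@leq_trans #|e |: Rt|); first by rewrite cardsU1 eRt'.
  apply/subset_leq_card/sub_component.
  - by apply: connU1 xRt _ => //; apply: share_sym.
  - rewrite subUset sub1set !inE eq_sym ge eR /=.
    apply/subsetP => h hRt; rewrite !inE; have := subsetP RtR _ hRt.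
    by rewrite !inE => /andP [_ ->]; rewrite andbT; apply: contraNneq gRt => <-.
  by rewrite inE tRt orbT.
have xR : x \in R by have := subsetP RtR _ xRt; rewrite !inE => /andP [].
have nce : ncol s e <= 4.
  apply: (@ncol_le_missing _ _ x) => //; rewrite ?ReE ?Rs //.
  by apply: shN => //; [apply: contraNneq eRt' => <-|rewrite share_sym].
have Dsub : D \subset R by apply/subsetP => g /DR [].
have ltRt : #|Rt| < #|R|.
  by apply: proper_card; apply: sub_proper_trans RtR _; rewrite properD1.
have [|||||||u uE ou] := extend_side (D := D) HF _ os (ReE _ eR) (Rs _ eR) st nce.
- rewrite -ltnS; apply: leq_trans Rn; apply: proper_card.
  by rewrite properE Dsub; apply/subsetPn; exists e => //; apply/negP => /DR [];
    rewrite eqxx.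
- by apply/negP => /DR []; rewrite eqxx.
- exact: subset_trans Dsub RE.
- by move=> g /DR [/Rs].
- by [].
- move=> g gD; have [gR ge gRt] := DR _ gD; apply/subsetP => h hN.
  have gt : g != t by apply: contraNneq gRt => ->.
  have [_ _ gh] := nbrP _ _ hN.
  case/orP: (RN _ gR gt _ hN) => [hR|hs]; last first.
    by case/negP: (nst _ gD); apply/orP; right; apply/hasP; exists h.
  rewrite in_setU1; case: eqVneq => //= he;
    rewrite in_setD in_setD1 he [h \in R]hR !andbT.
  by apply: contra gRt => hRt; apply: (component_closed hRt);
    rewrite ?inE ?ge // share_sym.
- move=> g gD; have [gR ge gRt] := DR _ gD; set Q := component _ _ _.
  have gQ : g \in Q by apply: component_refl.
  have QD : Q \subset D by apply: component_sub.
  have [||a [b [aQ]]] := conn_crossing cR (subset_trans QD Dsub).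
  + by apply/set0Pn; exists g.
  + by apply: contraTneq eR => <-; apply/negP => /(subsetP QD) /DR []; rewrite eqxx.
  rewrite in_setD => /andP [bQ bR] ab; exists a => //.
  have [<- //|be] := eqVneq b e; case/negP: bQ.
  apply: (component_closed aQ _ ab); rewrite in_setD in_setD1 be bR !andbT.
  have [aR ae aRt] := DR _ (subsetP QD _ aQ).
  by apply: contra aRt => bRt; apply: (component_closed bRt);
    rewrite ?inE ?ae // share_sym.
have [||||||||||v vE ov] := IH (rcons s e ++ u) Rt.
- exact: leq_trans ltRt Rm.
- exact: leq_trans (ltnW ltRt) Rn.
- exact: ou.
- by apply: subset_trans RtR _; apply: subset_trans (subD1set _ _) RE.
- move=> g gRt; have /setD1P [ge gR] := subsetP RtR _ gRt.
  rewrite mem_cat mem_rcons inE !negb_or ge Rs // uE in_setD gRt /=.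
  by [].
- exact: cRt.
- exact: tRt.
- exists x => //; apply/orP; right; apply/hasP; exists e => //.
  by rewrite mem_cat mem_rcons inE eqxx.
- move=> g gRt gt h hN; have /setD1P [ge gR] := subsetP RtR _ gRt.
  have [_ _ gh] := nbrP _ _ hN.
  change ((h \in Rt) || (h \in rcons s e ++ u)); rewrite mem_cat mem_rcons in_cons.
  case/orP: (RN _ gR gt _ hN) => [hR|hs]; last by rewrite [h \in s]hs !orbT.
  have [he|he] := eqVneq h e; first by rewrite orbT.
  by rewrite (component_closed gRt _ gh) // !inE he.
- move=> v vRt ov; rewrite -catA cat_rcons; apply: Ht; last by rewrite -cat_rcons catA.
  move=> g; rewrite inE mem_cat => /or3P [/eqP -> //||/vRt].
    by rewrite uE => /DR [gR ge gRt]; rewrite in_setD1 gR andbT;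
      apply: contraNneq gRt => ->.
  rewrite !in_setD1 => /andP [-> /(subsetP RtR)].
  by rewrite in_setD1 => /andP [_ ->].
exists (e :: u ++ v); last by rewrite -cat_rcons catA.
move=> g; rewrite inE mem_cat uE vE in_setD in_setD1.
have [-> //|ge] := eqVneq g e; rewrite /= ?eR //.
have [gRt|] := boolP (g \in Rt); rewrite ?orbF //=.
by have := subsetP RtR _ gRt; rewrite !inE => /andP [_ ->].
Qed.

(** For the part outside the component [Q], the edge [e] is a safe target because its neighbour in
    [Q] is still uncoloured; afterwards [Q] hangs on [e]. The neighbour of [e] outside [Q] ensures
    that [Q] meets only one endpoint of [e]. *)
Lemma extend_across_cut n s R e e0 : hanging_extension n -> #|R| <= n.+1 ->
  greedy_ok s -> R \subset edges G -> {in R, forall g, g \notin s} -> conn share R ->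
  {in R, forall g, {subset nbr g <= [predU R & s]}} -> e \in R ->
  e0 \in R :\ e -> {in component share (R :\ e) e0 & s, forall g h, ~~ share g h} ->
  (exists2 h, h \in nbr e & h \notin component share (R :\ e) e0) ->
  (exists2 h, h \in R :\: component share (R :\ e) e0 & startable s h) ->
  exists2 u : seq {set G}, u =i R & greedy_ok (s ++ u).
Proof.
move=> HF Rn os RE Rs cR RN eR e0R.
have := component_conn (@share_sym G) e0R; have := component_sub share (R :\ e) e0.
have := component_closed (e := share) (A := R :\ e) (x := e0).
have := conn_setD_component (@share_sym G) (x := e0) cR eR.
have : e0 \in component share (R :\ e) e0 by apply: component_refl.
move: (component share (R :\ e) e0) => Q e0Q cRQ clQ QRe cQ Qs [y yN yQ] [z zR zst].
have QR : Q \subset R := subset_trans QRe (subD1set _ _).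
have eQ : e \notin Q by apply/negP => /(subsetP QRe); rewrite !inE eqxx.
(* [Q] absorbs every edge other than [e] that meets it, so it touches the rest only through [e]. *)
have Qout g h : g \in Q -> h \in edges G -> h != e -> share g h -> h \in Q.
  move=> gQ hE he gh; have [-> //|hg] := eqVneq h g.
  have /(RN _ (subsetP QR _ gQ)) /orP [hR|hs] : h \in nbr g by apply/nbrP.
    by apply: (clQ _ _ gQ _ gh); apply/setD1P.
  by case/negP: (Qs _ _ gQ hs).
have [||q [b [qQ /setDP [bR bQ] qb]]] := conn_crossing cR QR.
- by apply/set0Pn; exists e0.
- by apply: contraTneq eR => <-.
have {b bR bQ qb} qe : share q e.
  have [<- //|be] := eqVneq b e; case/negP: bQ; apply: Qout qb => //.
  exact: (subsetP RE).
have qR := subsetP QR _ qQ.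
have eE := subsetP RE _ eR.
have qN : q \in nbr e.
  apply/nbrP; split; [exact: (subsetP RE)|by apply: contraNneq eQ => <-|].
  by rewrite share_sym.
have [|||||||||u uE ou] := @extend_to_target n s (R :\: Q) e HF.
- by apply: leq_trans Rn; apply/subset_leq_card/subsetDl.
- exact: os.
- exact: subset_trans (subsetDl _ _) RE.
- by move=> g /setDP [/Rs].
- exact: cRQ.
- exact/setDP.
- by exists z.
- move=> g /setDP [gR gQ] ge h hN; have [hE hg gh] := nbrP _ _ hN.
  case/orP: (RN _ gR _ hN) => [hR|hs]; last by apply/orP; right.
  apply/orP; left; apply/setDP; split=> //; apply: contra gQ => hQ.
  by apply: (Qout h); rewrite 1?share_sym // (subsetP RE).
- move=> u uR osu; apply: (@ncol_le_missing _ _ q) => //.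
    rewrite mem_cat negb_or Rs //; apply/negP => /uR.
    by rewrite !inE eqxx.
  rewrite mem_cat negb_or Rs //; apply/negP => /uR.
  by rewrite !inE qQ andbF.
(* [w] is the endpoint of [e] on the side of [Q], [v] the one on the coloured side. *)
have [w we wq] : exists2 w, w \in e & w \in q by apply/shareP; rewrite share_sym.
have [v wv eE'] := edges_at eE we.
have ve : v \in e by rewrite eE' !inE eqxx orbT.
have e2 x : x \in e -> x = w \/ x = v by rewrite eE' => /set2P.
have vy : v \in y.
  have [yE ye /shareP [x /e2 [] -> // wy]] := nbrP _ _ yN.
  by case/negP: yQ; apply: (Qout q) => //; apply: shareI wq wy.
have [||||||||||u' u'E ou'] := HF (s ++ u) Q e v.
- by rewrite -ltnS; apply: leq_trans Rn; apply: proper_card;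
    apply: sub_proper_trans QRe _; rewrite properD1.
- exact: ou.
- exact: subset_trans QR RE.
- move=> g gQ; rewrite mem_cat negb_or Rs ?(subsetP QR) //=.
  by rewrite uE inE gQ.
- by rewrite mem_cat uE inE eQ eR orbT.
- apply: (col_le3 ou _ ve); first by rewrite mem_cat uE inE eQ eR orbT.
  move=> g gs /shareP [x /e2 [] -> // wg].
  have [-> //|ge] := eqVneq g e.
  have gQ : g \in Q by apply: (Qout q) => //;
    [apply: greedy_ok_edges gs|apply: shareI wq wg].
  by move: gs; rewrite mem_cat uE inE gQ /= orbF (negPf (Rs _ (subsetP QR _ gQ))).
- exact: ve.
- move=> g gQ; apply: contra yQ => vg; have [yE ye _] := nbrP _ _ yN.
  by apply: (Qout g) => //; apply: shareI vg vy.
- move=> g gQ; apply/subsetP => h /nbrP [hE hg gh]; apply/setU1P.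
  by have [->|he] := eqVneq h e; [left|right; apply: (Qout g)].
- by move=> g gQ; exists q => //; apply: (subsetP (sub_component cQ _ gQ)).
exists (u ++ u'); last by rewrite catA.
move=> g; rewrite mem_cat uE u'E in_setD.
by have [gQ|] := boolP (g \in Q); rewrite ?orbF //= (subsetP QR).
Qed.

End Extension.

(** * Nonseparating lollipops *)

Lemma connP (T : finType) (e : rel T) (A : {set T}) : symmetric e ->
  reflect (conn e A) [forall x in A, component e A x == A].
Proof.
move=> e_sym; apply: (iffP forall_inP) => [h|cA x xA]; last first.
  by rewrite eqEsubset component_sub sub_component.
have [->|/set0Pn [x xA]] := eqVneq A set0; last first.
  by rewrite -(eqP (h x xA)); apply: component_conn.
by move=> B; rewrite subset0 => /eqP.
Qed.

Section Lollipop.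

Variable G : sgraph.
Implicit Types (X Y Z W K M : {set G}) (x y z v w : G) (l p : seq G).

Notation conn := (conn (@adj G)).
Let adjC : symmetric (@adj G) := @adj_sym G.

(** * Induced degrees, edge counts and cycles *)

Definition deg_in Y x := #|[set y in Y | adj x y]|.
(** Twice the number of edges induced by [Y], whence the doubled cardinals below. *)
Definition deg_sum Y := \sum_(x in Y) deg_in Y x.
Definition core X := (X != set0) && [forall x in X, 1 < deg_in X x].
(** Equivalent to [Y] inducing a subgraph with a cycle, in a form that counting can deliver. *)
Definition has_core Y := [exists X : {set G}, (X \subset Y) && core X].

Lemma deg_in_sub X Y x : X \subset Y -> deg_in X x <= deg_in Y x.
Proof.
move=> XY; apply: subset_leq_card; apply/subsetP => y.
by rewrite !inE => /andP [/(subsetP XY) -> ->].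
Qed.

Lemma deg_in_setU1 Y v x : v \notin Y -> deg_in (v |: Y) x = adj x v + deg_in Y x.
Proof.
move=> vY; have [xv|xv] := boolP (adj x v); last first.
  by apply: eq_card => y; rewrite !inE; case: eqVneq => //= ->; rewrite (negPf xv) andbF.
rewrite /deg_in (cardsD1 v) !inE eqxx xv /=; congr (_ + _).
apply: eq_card => y; rewrite !inE; case: eqVneq => //= ->.
by rewrite (negPf vY).
Qed.

Lemma deg_in_irrefl Y v : deg_in Y v = deg_in (Y :\ v) v.
Proof.
by apply: eq_card => y; rewrite !inE; case: eqVneq => //= ->; rewrite adj_irrefl andbF.
Qed.

Lemma deg_in_gt1 Y x y z : y \in Y -> z \in Y -> y != z -> adj x y -> adj x z -> 1 < deg_in Y x.
Proof.
move=> yY zY yz xy xz; apply: (@leq_trans #|[set y; z]|); first by rewrite cards2 yz.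
by apply: subset_leq_card; apply/subsetP => t /set2P [] ->; rewrite !inE ?yY ?zY.
Qed.

Lemma deg_in_nbr Y x (A : {set G}) : #|A| < deg_in Y x -> exists2 y, y \in Y :\: A & adj x y.
Proof.
move=> lt; have /subsetPn [y] : ~~ ([set y in Y | adj x y] \subset A).
  by apply: contraL lt => /subset_leq_card; rewrite -leqNgt.
by rewrite !inE => /andP [yY xy] yA; exists y; rewrite ?inE ?yA.
Qed.

Lemma deg_sum_setU1 v Y : v \notin Y -> deg_sum (v |: Y) = deg_sum Y + (deg_in Y v).*2.
Proof.
move=> vY; rewrite /deg_sum big_setU1 //= deg_in_setU1 // adj_irrefl add0n.
under eq_bigr => x _ do rewrite deg_in_setU1 //.
rewrite big_split /= (_ : \sum_(x in Y) adj x v = deg_in Y v).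
  by rewrite -addnn addnA addnC.
rewrite /deg_in -sum1_card big_mkcond [RHS]big_mkcond /=.
by apply: eq_bigr => x _; rewrite inE adj_sym; case: (x \in Y) => //; case: adj.
Qed.

Lemma deg_sum_setD1 v Y : v \in Y -> deg_sum Y = deg_sum (Y :\ v) + (deg_in Y v).*2.
Proof. by move=> vY; rewrite deg_in_irrefl -deg_sum_setU1 ?setD1K // !inE eqxx. Qed.

Lemma deg_sum1 v : deg_sum [set v] = 0.
Proof.
rewrite /deg_sum big_set1; apply: eq_card0 => y; rewrite !inE.
by case: eqVneq => // ->; rewrite adj_irrefl.
Qed.

Lemma has_coreW X Y : X \subset Y -> has_core X -> has_core Y.
Proof.
move=> XY /existsP [C /andP [CX cC]]; apply/existsP; exists C.
by rewrite cC (subset_trans CX).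
Qed.

(** Deleting a vertex of induced degree at most 1 preserves having at least as many edges as
    vertices, so the deletions stop at a core. *)
Lemma deg_sum_has_core Y : Y != set0 -> 2 * #|Y| <= deg_sum Y -> has_core Y.
Proof.
have [n] := ubnP #|Y|; elim: n Y => // n IH Y; rewrite ltnS => Yn Y0 exY.
have [cY|] := boolP (core Y); first by apply/existsP; exists Y; rewrite subxx.
rewrite /core Y0 => /forall_inPn [y yY]; rewrite -leqNgt => dy.
have E := deg_sum_setD1 yY; have C := cardsD1 y Y; rewrite yY in C.
apply: (has_coreW (subD1set Y y)); apply: IH; try by lia.
(* The deletions cannot exhaust [Y]: a single vertex spans no edge. *)
apply/eqP => Y1; move: E; rewrite Y1 /deg_sum big_set0 -/(deg_sum _); move: exY.
rewrite deg_in_irrefl Y1 (_ : deg_in set0 y = 0); first by lia.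
by apply: eq_card0 => z; rewrite !inE.
Qed.

Lemma core_deg_sum X : core X -> 2 * #|X| <= deg_sum X.
Proof.
case/andP=> _ /forall_inP h; rewrite mulnC -sum_nat_const.
exact: leq_sum.
Qed.

(** The excess of edges over vertices does not drop when [X] grows to the connected [Y]: each vertex
    is added next to the current set and brings an edge. *)
Lemma deg_sum_grow X Y : conn Y -> X \subset Y -> X != set0 ->
  deg_sum X + 2 * #|Y| <= deg_sum Y + 2 * #|X|.
Proof.
move=> cY; have [n] := ubnP #|Y :\: X|; elim: n X => // n IH X; rewrite ltnS => Yn XY X0.
have [->//|nXY] := eqVneq X Y.
have [x [y [xX /setDP [yY yX] xy]]] := conn_crossing cY XY X0 nXY.
have := IH (y |: X); rewrite cardsU1 yX deg_sum_setU1 // subUset sub1set yY XY.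
have d : 0 < deg_in X y by apply/card_gt0P; exists x; rewrite !inE xX adj_sym.
suff: #|Y :\: (y |: X)| < n /\ y |: X != set0.
  by case=> lt ne /(_ lt isT ne); lia.
split; last by apply/set0Pn; exists y; rewrite !inE eqxx.
apply: leq_trans Yn; apply: proper_card; apply/properP; split.
  by apply/setDS/subsetUr.
by exists y; rewrite !inE ?yX ?eqxx.
Qed.

(** The vertex added last finds all its neighbours in [Y] in place and brings two edges; the extra 2
    is that second edge, counted twice. *)
Lemma deg_sum_grow_strict X Y : conn Y -> X \proper Y -> X != set0 ->
  {in Y :\: X, forall y, 1 < deg_in Y y} -> deg_sum X + 2 * #|Y| + 2 <= deg_sum Y + 2 * #|X|.
Proof.
move=> cY; have [n] := ubnP #|Y :\: X|; elim: n X => // n IH X;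
  rewrite ltnS => Yn pXY X0 d2.
have XY := proper_sub pXY.
have nXY : X != Y by move: pXY; rewrite properEneq => /andP [].
have [x [y [xX /setDP [yY yX] xy]]] := conn_crossing cY XY X0 nXY.
have d : 0 < deg_in X y by apply/card_gt0P; exists x; rewrite !inE xX adj_sym.
have ne : y |: X != set0 by apply/set0Pn; exists y; rewrite !inE eqxx.
have sY : y |: X \subset Y by rewrite subUset sub1set yY XY.
have E := deg_sum_setU1 yX; have C := cardsU1 y X; rewrite yX in C.
have [YE|nY] := eqVneq (y |: X) Y.
  have : 1 < deg_in Y y by apply: d2; rewrite inE yX yY.
  by rewrite -YE deg_in_setU1 // adj_irrefl E C; lia.
have := IH (y |: X); rewrite E C properEneq nY sY.
suff: #|Y :\: (y |: X)| < n.
  move=> lt /(_ lt isT ne) h; suff: {in Y :\: (y |: X), forall z, 1 < deg_in Y z}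
    by move/h; lia.
  by move=> z; rewrite !inE negb_or -andbA => /and3P [_ zX zY]; apply: d2; rewrite inE zX.
apply: leq_trans Yn; apply: proper_card; apply/properP; split.
  by apply/setDS/subsetUr.
by exists y; rewrite !inE ?yX ?eqxx.
Qed.

Lemma conn_sorted l : sorted (@adj G) l -> conn [set x in l].
Proof.
elim: l => [|x [|y l] IH] /=.
- by move=> _ B; rewrite set_nil subset0 => /eqP.
- by move=> _; rewrite set_cons set_nil setU0; apply: conn1.
case/andP=> xy yl; rewrite set_cons; apply: (connU1 adjC (IH yl) (a := y)).
  by rewrite !inE eqxx.
by rewrite adj_sym.
Qed.

(** A connected [X] spans at least [#|X| - 1] edges and [v] adds two, so edges are no fewer than
    vertices. *)
Lemma has_core_closing X v : conn X -> v \notin X -> 1 < deg_in X v -> has_core (v |: X).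
Proof.
move=> cX vX dv; apply: deg_sum_has_core; first by apply/set0Pn; exists v;
  rewrite !inE eqxx.
have /card_gt0P [x] : 0 < deg_in X v by apply: leq_trans dv.
rewrite inE => /andP [xX _].
have := deg_sum_grow cX (X := [set x]); rewrite sub1set xX deg_sum1 cards1.
rewrite deg_sum_setU1 // cardsU1 vX => /(_ isT);
  suff: [set x] != set0 by move=> h /(_ h); lia.
by apply/set0Pn; exists x; rewrite inE.
Qed.

Lemma conn_delete_leaf Z z : conn Z -> deg_in Z z <= 1 -> conn (Z :\ z).
Proof.
move=> cZ dz B sB B0 clB.
have [zZ|zZ] := boolP (z \in Z); last first.
  have ZE : Z :\ z = Z.
    by apply/setP => y; rewrite !inE; case: eqVneq => // ->; rewrite (negPf zZ).
  by move: sB clB; rewrite ZE => sB clB; apply: cZ.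
have zB : z \notin B by apply/negP => /(subsetP sB); rewrite !inE eqxx.
have BZ : B \subset Z := subset_trans sB (subD1set _ _).
have [/existsP [n /andP [nB zn]]|hN] := boolP [exists n, (n \in B) && adj z n].
  suff <- : z |: B = Z by rewrite setU1K.
  apply: cZ; first by rewrite subUset sub1set zZ.
    by apply/set0Pn; exists z; rewrite !inE eqxx.
  move=> x y; rewrite !in_setU1 => h yZ xy.
  case: eqVneq => //= yz; case/orP: h => [/eqP xz|xB]; last first.
    by apply: (clB x) => //; rewrite !inE yz.
  apply: contraLR dz => yB; rewrite -ltnNge; apply: (@deg_in_gt1 _ _ n y) => //.
  - exact: (subsetP BZ).
  - by apply: contraNneq yB => <-.
  by rewrite -xz.
suff BE : B = Z by rewrite BE zZ in zB.
apply: cZ => // x y xB yZ xy; apply: (clB x) => //; rewrite !inE yZ andbT.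
apply: contraNneq hN => yz; apply/existsP; exists x; rewrite xB.
by rewrite adj_sym -yz.
Qed.

(** The path is prolonged at its free end [a], never at [x0], until it absorbs all neighbours of [a]
    in [Z]. *)
Lemma maximal_path Z x0 : x0 \in Z -> exists a l,
  [/\ uniq (a :: l), path (@adj G) a l, last a l = x0, {subset a :: l <= Z} &
      {in Z, forall y, adj a y -> y \in l}].
Proof.
move=> x0Z; suff H n a l : #|Z| - size l <= n ->
    [/\ uniq (a :: l), path (@adj G) a l, last a l = x0 & {subset a :: l <= Z}] ->
    exists a l, [/\ uniq (a :: l), path (@adj G) a l, last a l = x0,
      {subset a :: l <= Z} & {in Z, forall y, adj a y -> y \in l}].
  by apply: (H _ x0 [::] (leqnn _)); split=> // y; rewrite inE => /eqP ->.
elim: n a l => [|n IH] a l ln [ul pl la lZ].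
  have := uniq_leq_size ul (s2 := enum Z); rewrite /= -cardE.
  suff: {subset a :: l <= enum Z} by move=> h /(_ h); lia.
  by move=> y /lZ; rewrite mem_enum.
have [/existsP [y /and3P [yZ ay yl]]|h] :=
  boolP [exists y, [&& y \in Z, adj a y & y \notin a :: l]].
  apply: (IH y (a :: l)); first by rewrite /=; lia.
  split=> //; first by rewrite cons_uniq yl.
    by rewrite /= adj_sym ay.
  by move=> z; rewrite inE => /orP [/eqP ->|/lZ].
exists a, l; split=> // y yZ ay; apply: contraNT h => yl; apply/existsP; exists y.
by rewrite yZ ay inE negb_or yl eq_sym adj_neq.
Qed.

(* Paths are lists ending at the root, but their edges are listed from the root
   on: this is the order in which they get coloured. *)
Fixpoint pedges l : seq {set G} :=
  if l is a :: l' then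
    if l' is b :: _ then rcons (pedges l') [set a; b] else [::]
  else [::].

(** * Extremal choice of a connected set containing the root and a cycle *)

Section Optimal.

(* [rho] is the singleton of the root, or empty when [W] is the whole graph.
   [W_cut] says that no bridge separates a set [M] from the root. *)
Variables (W rho : {set G}).
Hypothesis W_conn : conn W.
Hypothesis W_neq0 : W != set0.
Hypothesis rho_sub : rho \subset W.
Hypothesis rho_le1 : #|rho| <= 1.
Hypothesis W_deg : {in W, forall x, deg_in W x = 3 - (x \in rho)}.
Hypothesis W_cut : forall M v, M \subset W :\: rho -> M != set0 -> v \in W :\: M ->
  (forall x y, x \in M -> y \in W :\: M -> adj x y -> y = v) -> deg_in M v <= 1 -> False.

(** The competitors of the extremal choice; connectedness is expressed by components to make the
    predicate boolean. *)
Definition trunk Z :=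
  [&& Z \subset W, rho \subset Z, has_core Z &
      [forall x in Z, component (@adj G) Z x == Z]].

Lemma trunkP Z : reflect [/\ Z \subset W, rho \subset Z, has_core Z & conn Z] (trunk Z).
Proof.
apply: (iffP and4P) => [] [? ? ?] h; split=> //; first exact/(connP Z adjC).
exact/(connP Z adjC).
Qed.

Lemma trunkW : trunk W.
Proof.
apply/trunkP; split=> //; apply/existsP; exists W; rewrite subxx /core W_neq0.
by apply/forall_inP => x xW; rewrite W_deg //; case: (x \in rho).
Qed.

(** [K] is made largest before [Z] is made smallest. The second choice ranges over the trunks
    avoiding this [K], but a trunk inside [Z] avoids it too, so [Z] is minimal among all trunks. *)
Lemma exists_optimal : exists Z K,
  [/\ trunk Z, conn K, K \subset W :\: Z,
      (forall Z' K', trunk Z' -> conn K' -> K' \subset W :\: Z' -> #|K'| <= #|K|) &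
      (forall Z', trunk Z' -> Z' \subset Z -> Z' = Z)].
Proof.
pose P (c : {set G} * {set G}) := [&& trunk c.1, c.2 \subset W :\: c.1 &
  [forall x in c.2, component (@adj G) c.2 x == c.2]].
have P0 : P (W, set0).
  by rewrite /P trunkW sub0set; apply/forall_inP => x; rewrite inE.
case: (arg_maxnP (fun c : {set G} * {set G} => #|c.2|) P0) => [[Z0 K]] /and3P [/= tZ0 KZ0].
move=> /(connP K adjC) cK Kmax.
pose P2 Z := trunk Z && (K \subset W :\: Z).
have P20 : P2 Z0 by rewrite /P2 tZ0.
case: (arg_minnP (fun Z : {set G} => #|Z|) P20) => Z /andP [tZ KZ] Zmin.
exists Z, K; split=> //.
  move=> Z' K' tZ' cK' K'Z'; apply: (Kmax (Z', K')).
  by rewrite /P tZ' K'Z'; apply/(connP K' adjC).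
move=> Z' tZ' sZ; apply/eqP; rewrite eqEcard sZ; apply: Zmin.
by rewrite /P2 tZ' (subset_trans KZ) // setDS.
Qed.

(** * Shape of a minimal trunk *)

Section Minimal.

Variable Z : {set G}.
Hypothesis Z_trunk : trunk Z.
Hypothesis Z_min : forall Z', trunk Z' -> Z' \subset Z -> Z' = Z.

Let ZW : Z \subset W. Proof. by case/trunkP: Z_trunk. Qed.
Let rhoZ : rho \subset Z. Proof. by case/trunkP: Z_trunk. Qed.
Let Z_core : has_core Z. Proof. by case/trunkP: Z_trunk. Qed.
Let Z_conn : conn Z. Proof. by case/trunkP: Z_trunk. Qed.

(** A vertex of induced degree at most 1, other than the root, could be deleted: it lies in no core
    and does not disconnect [Z]. *)
Lemma trunk_deg_in z : z \in Z -> z \notin rho -> 1 < deg_in Z z.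
Proof.
move=> zZ zr; rewrite ltnNge; apply/negP => dz.
suff /Z_min/(_ (subD1set _ _)) ZE : trunk (Z :\ z).
  by move: zZ; rewrite -ZE !inE eqxx.
apply/trunkP; split.
- exact: subset_trans (subD1set _ _) ZW.
- by rewrite subsetD1 rhoZ.
- case/existsP: Z_core => X /andP [XZ cX]; apply/existsP; exists X; rewrite cX andbT.
  rewrite subsetD1 XZ; apply: contraL dz => zX; rewrite -ltnNge.
  by case/andP: cX => _ /forall_inP /(_ z zX) h; apply: leq_trans h (deg_in_sub _ XZ).
exact: conn_delete_leaf.
Qed.

(** Such a path is itself a trunk, so it exhausts the minimal [Z]. Each unwanted chord is excluded
    below by a path of this kind that misses a vertex. *)
Lemma closing_path_spans b l : path (@adj G) b l -> {subset b :: l <= Z} ->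
  rho \subset [set x in b :: l] -> b \notin l -> 1 < deg_in [set x in l] b ->
  [set x in b :: l] = Z.
Proof.
move=> pl lZ rl bl db; apply: Z_min; last by apply/subsetP => x; rewrite inE => /lZ.
apply/trunkP; split=> //.
- by apply/subsetP => x; rewrite inE => /lZ /(subsetP ZW).
- rewrite set_cons; apply: has_core_closing; rewrite ?inE //.
  by apply: conn_sorted; apply: path_sorted pl.
exact: (@conn_sorted (b :: l)).
Qed.

(** A maximal path from the root ends at a vertex [a] whose neighbours in [Z] all lie on the path;
    besides its successor [b] there is another one, [w]. This closes a cycle, so the path exhausts
    [Z]. *)
Lemma lollipop_path : exists a b l w,
  [/\ uniq [:: a, b & l], path (@adj G) a (b :: l), [set x in [:: a, b & l]] = Z &
   [/\ w \in l, adj a w, rho \subset [set last b l] & rho = set0 -> w = last b l]].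
Proof.
have [x0 x0Z rx0] : exists2 x0, x0 \in Z & rho \subset [set x0].
  have [r0|/set0Pn [x xr]] := eqVneq rho set0.
    have /existsP [X /andP [XZ /andP [/set0Pn [x xX] _]]] := Z_core.
    by exists x; [apply: (subsetP XZ)|rewrite r0 sub0set].
  exists x; first exact: (subsetP rhoZ).
  by apply/subsetP => y yr; rewrite inE; apply/eqP; apply: (card_le1_eqP rho_le1).
have [a [l [ul pl la lZ amax]]] := maximal_path x0Z.
have aZ : a \in Z by apply: lZ; rewrite inE eqxx.
case: l ul pl la lZ amax => [|b l] ul pl la lZ amax.
  have noa : deg_in Z a = 0.
    by apply: eq_card0 => y; rewrite inE; apply/negP => /andP [yZ /(amax _ yZ)].
  have ZE : [set a] = Z.
    apply: Z_conn; rewrite ?sub1set //; first by apply/set0Pn; exists a; rewrite inE.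
    by move=> x y /set1P -> yZ /(amax _ yZ).
  have /existsP [X /andP [XZ /andP [/set0Pn [x xX] /forall_inP /(_ x xX)]]] := Z_core.
  have /set1P -> : x \in [set a] by rewrite ZE (subsetP XZ).
  by move/leq_trans/(_ (deg_in_sub _ XZ)); rewrite noa.
rewrite /= in la.
have ar : a \notin rho.
  apply/negP => /(subsetP rx0) /set1P aE; move: ul; rewrite cons_uniq => /andP [].
  by rewrite aE -la mem_last.
have [w /setDP [wZ wb] aw] : exists2 w, w \in Z :\: [set b] & adj a w.
  by apply: deg_in_nbr; rewrite cards1 trunk_deg_in.
have wl : w \in l by move: (amax _ wZ aw) wb; rewrite !inE => /orP [->|].
have ab : adj a b by case/andP: pl.
have bl : b \notin l by move: ul => /= /and3P [].
have spans l' : path (@adj G) a (b :: l') -> {subset b :: l' <= b :: l} ->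
    rho \subset [set x in [:: a, b & l']] -> w \in l' -> [set x in [:: a, b & l']] = Z.
  move=> pl' l'l rl' wl'; apply: closing_path_spans => //.
  - by move=> x; rewrite inE => /orP [/eqP -> //|/l'l xl]; apply: lZ; rewrite inE xl orbT.
  - by apply/negP => /l'l; apply/negP; case/andP: ul.
  apply: (@deg_in_gt1 _ _ b w) => //; rewrite ?inE ?eqxx ?wl' ?orbT //.
  by apply: contraNneq bl => ->.
(* Without a root, the part of the path beyond [w] is cut off, which leaves a cycle. *)
have [r0|nr0] := eqVneq rho set0; last first.
  exists a, b, l, w; split=> //; last first.
    by split=> //; rewrite ?la // => r0; rewrite r0 eqxx in nr0.
  apply: spans => //; apply: subset_trans rx0 _; rewrite sub1set inE -la.
  exact: (@mem_last _ a (b :: l)).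
case/splitPr: wl ul pl spans {la lZ amax bl} => l1 l2 ul pl spans.
have sub : {subset b :: rcons l1 w <= b :: (l1 ++ w :: l2)}.
  move=> x; rewrite !inE mem_rcons mem_cat !inE => /or3P [->|->|->]; rewrite ?orbT //.
have pl' : path (@adj G) a (b :: rcons l1 w).
  by move: pl; rewrite -cat_rcons -cat_cons cat_path => /andP [].
exists a, b, (rcons l1 w), w; split=> //.
- by move: ul; rewrite -cat_rcons -!cat_cons cat_uniq => /andP [].
- by apply: spans => //; rewrite ?r0 ?sub0set // mem_rcons inE eqxx.
by split=> //; rewrite ?last_rcons ?r0 ?sub0set // mem_rcons inE eqxx.
Qed.

(** * Absence of chords, and edges leaving the lollipop *)

Section Path.

Variables (a b w : G) (l : seq G).
Let p := [:: a, b & l].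
Hypothesis p_uniq : uniq p.
Hypothesis p_path : path (@adj G) a (b :: l).
Hypothesis p_set : [set x in p] = Z.
Hypothesis w_l : w \in l.
Hypothesis a_w : adj a w.
Hypothesis rho_last : rho \subset [set last b l].

Lemma mem_trunk x : (x \in Z) = (x \in p).
Proof. by rewrite -p_set inE. Qed.

(** A chord from [c] to a later vertex would close a cycle with the rest of the path, giving a trunk
    that misses [a]. *)
Lemma path_nbr p1 c l1 y : p = p1 ++ c :: l1 -> p1 != [::] -> y \in l1 -> adj c y ->
  y = head c l1.
Proof.
move=> pE p10; case: l1 pE => // d l2 pE; rewrite inE => /orP [/eqP //|yl2] cy.
have := p_uniq; rewrite pE cat_uniq => /and3P [_ /hasPn p1p] ucd.
have sp : sorted (@adj G) (p1 ++ [:: c, d & l2]) by rewrite -pE.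
have pcd : path (@adj G) c (d :: l2) by have [] := cat_sorted2 sp.
suff ZE : [set x in [:: c, d & l2]] = Z.
  have : a \in Z by rewrite mem_trunk inE eqxx.
  rewrite -ZE inE => /p1p; case: p1 pE p10 {p1p sp} => // a' p1 [<- _] _.
  by rewrite inE eqxx.
apply: closing_path_spans => //.
- by move=> x xc; rewrite mem_trunk pE mem_cat xc orbT.
- apply: subset_trans rho_last _; rewrite sub1set inE.
  have -> : last b l = last c (d :: l2).
    by rewrite -[last b l]/(last a p) pE last_cat.
  exact: mem_last.
- by case/andP: ucd.
apply: (@deg_in_gt1 _ _ d y) => //; rewrite ?inE ?eqxx ?yl2 ?orbT //.
  by apply: contraTneq ucd => ->; rewrite /= yl2 !andbF.
by case/andP: pcd.
Qed.

(** Given two neighbours [c], [d] of [a] in [l], in this order, jumping from [a] to [c] keeps the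
    cycle closed at [d] and gives a trunk that misses [b]. *)
Lemma apex_nbr y : y \in l -> adj a y -> y = w.
Proof.
move=> yl ay; apply/eqP/negPn/negP => yw.
have [l1 [c [l2 [d [lE dl2 ac ad]]]]] : exists l1 c l2 d,
    [/\ l = l1 ++ c :: l2, d \in l2, adj a c & adj a d].
  case/splitPr: w_l (yl) => l1 l2; rewrite mem_cat inE (negPf yw) /= => /orP [yl1|yl2].
    case/splitPr: yl1 => l3 l4; exists l3, y, (l4 ++ w :: l2), w.
    by rewrite -catA mem_cat inE eqxx orbT.
  by exists l1, w, l2, y.
have := p_uniq; rewrite /p lE /= !inE !mem_cat !inE !negb_or.
move=> /andP [/and4P [nab nal1 nac nal2] /andP [/and3P [nbl1 nbc nbl2]]].
rewrite cat_uniq => /and3P [_ _ /andP [cl2 _]].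
suff ZE : [set x in [:: a, c & l2]] = Z.
  have : b \in Z by rewrite mem_trunk !inE eqxx orbT.
  by rewrite -ZE !inE eq_sym (negPf nab) (negPf nbc) (negPf nbl2).
apply: closing_path_spans => /=.
- rewrite ac; move: p_path; rewrite lE /= => /andP [_].
  by rewrite cat_path => /andP [_] /= /andP [].
- move=> x; rewrite mem_trunk /p lE !inE mem_cat !inE.
  by case/or3P=> ->; rewrite ?orbT.
- apply: subset_trans rho_last _; rewrite sub1set lE last_cat /= !inE.
  by have := mem_last c l2; rewrite !inE => ->; rewrite orbT.
- by rewrite inE negb_or nac.
apply: (@deg_in_gt1 _ _ c d) => //; rewrite ?inE ?eqxx ?dl2 ?orbT //.
by apply: contraNneq cl2 => ->.
Qed.

Lemma chordless x y : x \in Z -> y \in Z -> adj x y ->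
  [set x; y] \in pedges p \/ [set x; y] = [set a; w].
Proof.
rewrite !mem_trunk.
have H p1 l1 : p = p1 ++ l1 -> p1 != [::] -> {in l1 &, forall x y, adj x y -> [set x; y] \in pedges l1}.
  elim: l1 p1 => // c l1 IH p1 pE p10.
  have head_edge z : z \in l1 -> adj c z -> [set c; z] \in pedges (c :: l1).
    move=> zl cz; rewrite (path_nbr pE p10 zl cz); case: (l1) zl => //= d l2 _.
    by rewrite mem_rcons inE eqxx.
  move=> x' y'; rewrite !inE; have [->|xc] := eqVneq x' c;
    have [->|yc] := eqVneq y' c => /=.
  - by rewrite adj_irrefl.
  - by move=> _; apply: head_edge.
  - by move=> xl _ xy; rewrite setUC; apply: head_edge; rewrite // adj_sym.
  move=> xl yl xy; have := IH (rcons p1 c); rewrite cat_rcons => /(_ pE).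
  move=> /(_ _ x' y' xl yl xy) h; case: (l1) xl h => //= d l2 _ h.
  by rewrite mem_rcons inE h ?orbT //; case: (p1).
have apex z : z \in b :: l -> adj a z -> [set a; z] \in pedges p \/ [set a; z] = [set a; w].
  rewrite inE => /orP [/eqP ->|zl] az; first by left; rewrite mem_rcons inE eqxx.
  by right; rewrite (apex_nbr zl az).
rewrite inE [y \in p]inE; have [->|xa] := eqVneq x a; have [->|ya] := eqVneq y a => /=.
- by rewrite adj_irrefl.
- by move=> _; apply: apex.
- by move=> xl _ xy; rewrite setUC; apply: apex; rewrite // adj_sym.
move=> xl yl xy; left; rewrite /p /= mem_rcons inE.
by rewrite (H [:: a] (b :: l)) ?orbT.
Qed.

(** Not being the root, [a] has degree 3 in [W], while [b] and [w] are its only neighbours in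
    [Z]. *)
Lemma apex_outside : exists2 k, k \in W :\: Z & adj a k.
Proof.
have ar : a \notin rho.
  apply/negP => /(subsetP rho_last) /set1P aE; have := p_uniq.
  by rewrite cons_uniq {1}aE mem_last.
have aW : a \in W by apply: (subsetP ZW); rewrite mem_trunk inE eqxx.
have [y /setDP [yW yA] ay] : exists2 y, y \in W :\: [set b; w] & adj a y.
  by apply: deg_in_nbr; rewrite W_deg // (negPf ar) cards2; case: (_ != _).
exists y => //; rewrite inE yW andbT mem_trunk; apply: contraNN yA.
rewrite !inE eq_sym (negPf (adj_neq ay)) /= => /orP [-> //|yl].
by rewrite (apex_nbr yl ay) eqxx orbT.
Qed.

Lemma second_outside : exists2 k, k \in W :\: Z & adj b k.
Proof.
have bl : b \notin l by case/and3P: p_uniq.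
have br : b \notin rho.
  apply/negP => /(subsetP rho_last) /set1P bE.
  by case: (l) w_l bl bE => //= d l2 _ bl bE; rewrite bE mem_last in bl.
have bW : b \in W by apply: (subsetP ZW); rewrite mem_trunk !inE eqxx orbT.
have [y /setDP [yW yA] yb] : exists2 y, y \in W :\: [set a; head b l] & adj b y.
  by apply: deg_in_nbr; rewrite W_deg // (negPf br) cards2; case: (_ != _).
exists y => //; rewrite inE yW andbT mem_trunk; apply: contraNN yA.
rewrite !inE [y == b]eq_sym (negPf (adj_neq yb)) /= => /orP [-> //|yl].
by rewrite (@path_nbr [:: a] b l y) // eqxx orbT.
Qed.

Lemma last_outside : w = last b l -> rho = set0 -> exists2 k, k \in W :\: Z & adj w k.
Proof.
move=> wE r0; have wW : w \in W by apply: (subsetP ZW); rewrite mem_trunk !inE w_l !orbT.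
have memZ := mem_trunk; have up := p_uniq; have pnbr := path_nbr;
  rewrite /p in memZ up pnbr.
case: (lastP l) w_l wE memZ up pnbr => // l' w' _; rewrite last_rcons => <- memZ up pnbr.
have [y /setDP [yW yA] wy] : exists2 y, y \in W :\: [set a; last b l'] & adj w y.
  by apply: deg_in_nbr; rewrite W_deg // r0 inE cards2; case: (_ != _).
exists y => //; rewrite inE yW andbT memZ; apply: contraNN yA.
rewrite in_set2 inE; case: eqVneq => //= ya.
rewrite -rcons_cons mem_rcons inE eq_sym (negPf (adj_neq wy)) /= => yl.
case/splitPr E: {1}(b :: l') / yl => [A1 A2].
have pE : [:: a, b & rcons l' w] = (a :: A1) ++ y :: rcons A2 w.
  by rewrite -rcons_cons E rcons_cat.
have := pnbr _ _ _ w pE isT; rewrite mem_rcons inE eqxx adj_sym => /(_ isT wy).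
case: A2 E pE => [|d A2] E pE /=.
  by move=> _; rewrite -[last b l']/(last b (b :: l')) E last_cat.
move=> wd; have : w \in b :: l' by rewrite E wd mem_cat !inE eqxx !orbT.
by move: up; rewrite -!rcons_cons rcons_uniq inE negb_or => /andP [/andP [_ /negPf ->]].
Qed.

End Path.

End Minimal.

(** * Connectedness of the complement *)

Lemma deg_in_disjoint X Y (A : {set G}) x : X \subset Y -> A \subset Y -> [disjoint X & A] ->
  {in A, forall y, adj x y} -> deg_in X x + #|A| <= deg_in Y x.
Proof.
move=> XY AY dXA Ax; rewrite /deg_in -cardsUI.
have -> : [set y in X | adj x y] :&: A = set0.
  by apply/eqP; rewrite setI_eq0; apply: disjointWl dXA; apply/subsetP => y;
    rewrite inE => /andP [].
rewrite cards0 addn0; apply: subset_leq_card; apply/subsetP => y; rewrite !inE.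
by case/orP=> [/andP [/(subsetP XY) -> ->]|yA] //; rewrite (subsetP AY) ?Ax.
Qed.

Lemma split_first (P : pred G) p : has P p ->
  exists A v B, [/\ p = A ++ v :: B, P v & ~~ has P A].
Proof.
elim: p => //= x p IH; have [Px _|nPx /= /IH [A [v [B [-> Pv nA]]]]] := boolP (P x).
  by exists [::], x, p.
by exists (x :: A), v, B; rewrite /= negb_or nPx.
Qed.

(* If [Z - v] is connected and [W - Z] has a vertex outside [K], counting degrees
   yields a cycle avoiding [v], so [K + v] would be a better choice than [K]. *)
Lemma optimal_complement Z K a b w l :
  trunk Z -> conn K -> K \subset W :\: Z ->
  (forall Z' K', trunk Z' -> conn K' -> K' \subset W :\: Z' -> #|K'| <= #|K|) ->
  (forall Z', trunk Z' -> Z' \subset Z -> Z' = Z) ->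
  uniq [:: a, b & l] -> path (@adj G) a (b :: l) -> [set x in [:: a, b & l]] = Z ->
  w \in l -> adj a w -> rho \subset [set last b l] -> (rho = set0 -> w = last b l) ->
  W :\: Z = K.
Proof.
move=> tZ cK KWZ Kmax Zmin up pp pZ wl aw rl r0w.
have [ZW rZ hZ cZ] := trunkP _ tZ.
have KW : K \subset W := subset_trans KWZ (subsetDl _ _).
have KZ x : x \in K -> x \notin Z by move/(subsetP KWZ); rewrite inE => /andP [].
(* A trunk avoiding both [K] and a vertex adjacent to [K] would allow [K] to be enlarged by that
   vertex. *)
have Kmax' Y v : trunk Y -> v \in W :\: Y -> v \notin K -> K \subset W :\: Y ->
    (exists2 k, k \in K & adj v k) -> False.
  move=> tY vY vK KY [k kK vk].
  have := Kmax Y (v |: K) tY; rewrite cardsU1 vK ltnn subUset sub1set vY KY.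
  move=> h; suff: conn (v |: K) by move/h => /(_ isT).
  by apply: connU1 cK kK _ => //; rewrite adj_sym.
have Kcl x y : x \in K -> y \in W :\: Z -> adj x y -> y \in K.
  move=> xK yW xy; apply/negPn/negP => yK; apply: (Kmax' Z y) => //.
  by exists x => //; rewrite adj_sym.
have [k0 k0W ak0] := apex_outside tZ Zmin up pp pZ wl aw rl.
have K0 : K != set0.
  have := Kmax Z [set k0] tZ (@conn1 _ _ k0); rewrite sub1set cards1 => /(_ k0W).
  by rewrite card_gt0.
have memp := mem_trunk pZ.
have pK x : x \in [:: a, b & l] -> x \notin K.
  by rewrite -memp; apply: contraL => /KZ.
pose att x := [exists k, (k \in K) && adj x k].
have attP x : att x -> exists2 k, k \in K & adj x k.
  by case/existsP => k /andP []; exists k.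
have att_p : has att [:: a, b & l].
  have [||x [y [xK /setDP [yW yK] xy]]] := conn_crossing W_conn KW => //.
    by apply: contraTneq k0W => KE; apply/negP => _; have := KZ a;
      rewrite KE memp inE eqxx (subsetP ZW) ?memp ?inE ?eqxx // => /(_ isT).
  apply/hasP; exists y; last by apply/existsP; exists x; rewrite xK adj_sym.
  rewrite -memp; apply: contraNT yK => yZ; apply: Kcl xy => //.
  by rewrite inE yZ.
(* [v] is the first vertex from [a] on that is adjacent to [K]; no vertex of [A] is. *)
have [A [v [B [pE /attP [k kK vk] nA]]]] := split_first att_p.
have vp : v \in [:: a, b & l] by rewrite pE mem_cat inE eqxx orbT.
have vZ : v \in Z by rewrite memp.
have vW : v \in W := subsetP ZW _ vZ.
have vK : v \notin K := pK _ vp.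
have kW : k \in W := subsetP KW _ kK.
have := up; rewrite pE cat_uniq => /and3P [uA /= /norP [vA /hasPn AB] /andP [vB uB]].
have sp : sorted (@adj G) (A ++ v :: B) by rewrite -pE.
have [sA pvB] := cat_sorted2 sp.
have sB := path_sorted pvB.
have lastE : last b l = last v B
  by rewrite -[last b l]/(last a [:: a, b & l]) pE last_cat.
have subW l1 : {subset l1 <= A ++ B} -> [set x in l1] \subset W :\: (v |: K).
  move=> h; apply/subsetP => x; rewrite inE => /h; rewrite mem_cat => xAB.
  have xp : x \in [:: a, b & l] by rewrite pE mem_cat inE; case/orP: xAB => ->;
    rewrite ?orbT.
  rewrite !inE (negPf (pK _ xp)) orbF (subsetP ZW) ?memp // andbT.
  by case/orP: xAB; apply: contraTneq => ->.
have AW : [set x in A] \subset W :\: (v |: K) by apply: subW => x; rewrite mem_cat => ->.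
have BW : [set x in B] \subset W :\: (v |: K) by apply: subW => x;
  rewrite mem_cat orbC => ->.
have KY Y : Y \subset W :\: (v |: K) -> K \subset W :\: Y.
  move=> YW; apply/subsetP => x xK; rewrite inE (subsetP KW) // andbT.
  by apply/negP => /(subsetP YW); rewrite !inE xK orbT.
have vY Y : Y \subset W :\: (v |: K) -> v \in W :\: Y.
  move=> YW; rewrite inE vW andbT.
  by apply/negP => /(subsetP YW); rewrite !inE eqxx.
have no_trunk Y : Y \subset W :\: (v |: K) -> trunk Y -> False.
  by move=> YW tY; apply: (Kmax' Y v tY) => //; [apply: vY|apply: KY|exists k].
have wa : w != a by apply: contraTneq up => <-; rewrite /= inE wl orbT.
have wb : w != b by apply: contraTneq up => <-; rewrite /= wl !andbF.
have ab : adj a b by case/andP: pp.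
have split_A : w \in v :: B -> A = [::] \/ exists A1, A = a :: A1.
  by case: (A) pE => [|a1 A1]; [left|case=> <- _; right; exists A1].
have A2 : w \in rcons A v -> exists A2, A = [:: a, b & A2].
  case: (A) pE => [|a1 [|b1 A2]] [<-].
  - by rewrite inE => _ /eqP wE; rewrite wE eqxx in wa.
  - by move=> <- _; rewrite !inE (negPf wa) (negPf wb).
  by move=> <- _ _; exists A2.
pose U := W :\: (v |: K).
have vrho c B1 : B = c :: B1 -> v \notin rho.
  move=> BE; apply/negP => /(subsetP rl) /set1P; rewrite lastE BE /= => vE.
  by move: vB; rewrite BE {1}vE mem_last.
have vdeg c B1 : B = c :: B1 -> deg_in W v = 3 by move=> /vrho vr;
  rewrite W_deg // (negPf vr).
have vdeg0 : B = [::] -> rho != set0 -> deg_in W v = 2.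
  move=> BE /set0Pn [r rr]; rewrite W_deg //; have := subsetP rl _ rr.
  by rewrite lastE BE /= => /set1P <-; rewrite rr.
(* Otherwise the whole cycle precedes [v] and a bridge at [v] appears. The part [Y] of [U] joined to
   the root end misses [a], or it would be a trunk avoiding [v]; so only [v] separates [U :\: Y]
   from the rest of [W]. *)
have wA : w \notin A.
  apply/negP => wA; have [|A3 AE] := A2; first by rewrite mem_rcons inE wA orbT.
  pose x0 := last v B.
  pose Y := if x0 \in U then component (@adj G) U x0 else set0.
  have YU : Y \subset U by rewrite /Y; case: ifP => _; rewrite ?component_sub ?sub0set.
  have Ycl : closed_in (@adj G) U Y.
    rewrite /Y; case: ifP => _; first exact: component_closed.
    by move=> x y; rewrite inE.
  have x0B : B != [::] -> x0 \in B by rewrite /x0; case: (B) => //= c B1 _;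
    apply: mem_last.
  have BY : {subset B <= Y}.
    move=> x xB; have /x0B x0b : B != [::] by case: (B) xB.
    have x0U : x0 \in U by apply: (subsetP BW); rewrite inE.
    rewrite /Y x0U; apply: (subsetP (sub_component (conn_sorted sB) BW _)).
      by rewrite inE.
    by rewrite inE.
  have aY : a \notin Y.
    apply/negP => aY; apply: (no_trunk Y) => //.
    have x0U : x0 \in U by apply: contraTT aY => /negPf; rewrite /Y => ->; rewrite inE.
    have AY : [set x in A] \subset Y.
      by apply: (conn_sub (conn_sorted sA) AW Ycl aY); rewrite inE AE inE eqxx.
    apply/trunkP; split.
    - exact: subset_trans YU (subsetDl _ _).
    - apply: subset_trans rl _; rewrite lastE sub1set /Y x0U.
      exact: component_refl.
    - apply: has_coreW AY _; rewrite AE set_cons; apply: has_core_closing.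
      + by apply: conn_sorted; move: sA; rewrite AE => /path_sorted.
      + by have := uA; rewrite AE cons_uniq in_set => /andP [].
      have wA3 : w \in b :: A3 by move: wA; rewrite AE inE (negPf wa).
      by apply: (@deg_in_gt1 _ _ b w) => //; rewrite 1?eq_sym // in_set // inE eqxx.
    by rewrite /Y x0U; apply: (component_conn adjC).
  have memM x : (x \in U :\: Y) = [&& x \notin Y, x != v, x \notin K & x \in W].
    by rewrite in_setD /U in_setD in_setU1 negb_or -!andbA.
  have vM : v \notin U :\: Y by rewrite memM eqxx /= andbF.
  have kM : k \notin U :\: Y by rewrite memM kK /= !andbF.
  have MW : U :\: Y \subset W by apply/subsetP => x; rewrite memM => /and4P [].
  apply: (@W_cut (U :\: Y) v).
  - apply/subsetP => m mM; have := mM; rewrite memM in_setD => /and4P [mY mv mK mW].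
    rewrite mW andbT; apply/negP => /(subsetP rl); rewrite lastE => /set1P mE.
    have := mem_last v B; rewrite -mE inE (negPf mv) => /BY.
    by apply/negP.
  - apply/set0Pn; exists a; rewrite in_setD aY (subsetP AW) //.
    by rewrite inE AE inE eqxx.
  - by rewrite in_setD vM.
  - move=> m y mM; rewrite in_setD memM => /andP [+ yW] my.
    have := mM; rewrite memM => /and4P [mY mv mK mW].
    have yK : y \notin K.
      apply/negP => yK; have [mZ|mZ] := boolP (m \in Z); last first.
        by case/negP: mK; apply: (Kcl y) => //; rewrite ?in_setD ?mZ // adj_sym.
      move: mZ; rewrite memp pE mem_cat inE (negPf mv) /= => /orP [mA|/BY].
        by case/hasP: nA; exists m => //; apply/existsP; exists y; rewrite yK.
      by apply/negP.
    case: eqVneq => // yv; rewrite yK yW /= !andbT negbK => yY.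
    case/negP: mY; apply: (Ycl y) => //; last by rewrite adj_sym.
    by rewrite in_setD in_setU1 negb_or mv mK.
  (* [v] spends one edge on [k] and another on its successor [c], or is the root and has degree 2;
     at most one is left for [U :\: Y]. *)
  case BE: B => [|c B1].
    have := @deg_in_disjoint (U :\: Y) W [set k] v MW; rewrite sub1set cards1 vdeg0 //.
      move=> /(_ kW) h; suff: deg_in (U :\: Y) v + 1 <= 2 by rewrite addn1.
      apply: h; first by rewrite disjoint_sym disjoints1.
      by move=> y /set1P ->.
    apply/negP => /eqP /r0w; rewrite lastE BE /= => wv.
    by rewrite wv (negPf vA) in wA.
  have cY : c \in Y by apply: BY; rewrite BE inE eqxx.
  have kc : k != c.
    apply: contraTneq kK => ->; apply: pK.
    by rewrite pE BE mem_cat !inE eqxx !orbT.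
  have := @deg_in_disjoint (U :\: Y) W [set k; c] v MW; rewrite cards2 kc (vdeg _ _ BE).
  move=> h; suff: deg_in (U :\: Y) v + 2 <= 3 by rewrite addn2.
  apply: h.
  - rewrite subUset !sub1set kW; have := subsetP YU _ cY.
    by rewrite in_setD => /andP [].
  - rewrite disjoint_sym disjoints_subset; apply/subsetP => x /set2P [] ->.
      by rewrite in_setC.
    by rewrite in_setC in_setD cY.
  move=> y /set2P [] -> //; by move: pvB; rewrite BE => /andP [].
have wvB : w \in v :: B.
  have : w \in [:: a, b & l] by rewrite !inE wl !orbT.
  by rewrite pE mem_cat (negPf wA).
(* With a root, [w] would have the neighbours [a], its predecessor [c] and [k]: too many if it is
   the root, and no room for its successor if it is not. *)
have vwr : v = w -> rho = set0.
  move=> vw; apply/eqP/negPn/negP => rn0.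
  have [|A3 AE] := A2; first by rewrite mem_rcons inE vw eqxx.
  pose c := last b A3.
  have cv : adj v c.
    have := sp; rewrite AE /= => /andP [_]; rewrite cat_path => /andP [_] /= /andP [h _].
    by rewrite adj_sym.
  have cA : c \in A by rewrite AE inE mem_last orbT.
  have ca : c != a.
    apply: contraTneq uA => cE; rewrite AE /=.
    by have := mem_last b A3; rewrite -/c cE => ->.
  have aA : a \in A by rewrite AE inE eqxx.
  have memAW x : x \in A -> x \in W.
    move=> xA; have : x \in [set x in A] by rewrite inE.
    by move/(subsetP AW); rewrite in_setD => /andP [].
  have kA x : x \in A -> k != x.
    move=> xA; apply: contraTneq kK => ->; apply: pK.
    by rewrite pE mem_cat xA.
  have kB : k \notin B.
    by apply: contraTN kK => kB; apply: pK; rewrite pE mem_cat inE kB !orbT.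
  have BW' : [set x in B] \subset W by apply: subset_trans BW (subsetDl _ _).
  have := @deg_in_disjoint [set x in B] W (k |: [set a; c]) v BW'.
  have -> : #|k |: [set a; c]| = 3.
    by rewrite cardsU1 cards2 eq_sym ca !inE negb_or !kA.
  move=> h; have {h} : deg_in [set x in B] v + 3 <= deg_in W v.
    apply: h.
    - by rewrite subUset sub1set kW subUset !sub1set !memAW.
    - rewrite disjoint_sym disjoints_subset; apply/subsetP => x.
      rewrite in_setC in_set => /setU1P [-> //|/set2P [] ->];
        first by apply: contraL aA => /AB.
      by apply: contraL cA => /AB.
    by move=> y /setU1P [-> //|/set2P [] -> //]; rewrite vw adj_sym.
  case BE: B => [|d B1]; first by rewrite vdeg0 // addn3.
  rewrite (vdeg _ _ BE) addn3 !ltnS leqn0 cards_eq0 => /eqP/setP/(_ d).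
  by have := pvB; rewrite BE /= => /andP [vd _]; rewrite !inE eqxx vd.
have vr : v \notin rho.
  have [vw|vw] := eqVneq v w; first by rewrite vwr // inE.
  case BE: B => [|d B1]; last exact: vrho BE.
  by move: wvB; rewrite BE inE eq_sym (negPf vw).
have ZvE : Z :\ v = [set x in A] :|: [set x in B].
  apply/setP => x; rewrite in_setD1 memp pE mem_cat in_setU !in_set inE.
  case: eqVneq => [->|] //=; by rewrite (negPf vA) (negPf vB).
(* If [v] is [w], nothing follows it; otherwise the closing edge from [a] to [w] links what precedes
   [v] to what follows. *)
have cZv : conn (Z :\ v).
  rewrite ZvE; have [vw|vw] := eqVneq v w.
    have BE : B = [::].
      case BE: B => [|d B1] //; have := r0w (vwr vw); rewrite lastE BE -vw /= => vE.
      by move: vB; rewrite BE {1}vE mem_last.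
    by rewrite BE set_nil setU0; apply: conn_sorted.
  have wB : w \in B by move: wvB; rewrite inE eq_sym (negPf vw).
  case: (split_A wvB) => [->|[A1 AE]]; first by rewrite set_nil set0U; apply: conn_sorted.
  apply: (connU adjC (conn_sorted sA) (conn_sorted sB) _ _ aw); last by rewrite in_set.
  by rewrite in_set AE inE eqxx.
have dW : deg_in W v = 3 by rewrite W_deg // (negPf vr).
have dZ : 1 < deg_in Z v by apply: (trunk_deg_in tZ).
have kZ : k \notin Z by apply: KZ.
have dZ2 : deg_in Z v <= 2.
  have := @deg_in_disjoint Z W [set k] v ZW; rewrite cards1 dW addn1 sub1set kW.
  apply=> //; first by rewrite disjoint_sym disjoints1.
  by move=> y /set1P ->.
have vnbr x : x \in W -> adj v x -> (x \in Z) || (x \in K).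
  move=> xW vx; apply/negPn/negP => /norP [xZ xK].
  have := @deg_in_disjoint Z W [set k; x] v ZW.
  rewrite cards2 (_ : k != x) ?dW; last by apply: contraNneq xK => <-.
  rewrite addn2 subUset !sub1set kW xW => /(_ isT) h.
  suff: deg_in Z v < 2 by rewrite ltnNge dZ.
  apply: h; last by move=> y /set2P [] ->.
  rewrite disjoint_sym disjoints_subset; apply/subsetP => y /set2P [] ->;
    by rewrite in_setC.
have ZvU : Z :\ v \subset U.
  by rewrite ZvE subUset AW BW.
have memU x : (x \in U) = [&& x != v, x \notin K & x \in W].
  by rewrite /U in_setD in_setU1 negb_or -andbA.
(* A component of [U] missing [Z :\ v] would have no neighbour in [K], which is closed in [W :\: Z],
   and would not see [v] by [vnbr]; so it would be all of [W]. *)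
have cU : conn U.
  have meets (C : {set G}) : C \subset U -> C != set0 -> closed_in (@adj G) U C -> Z :\ v \subset C.
    move=> CU C0 clC; apply: (closed_in_sub cZv ZvU clC); apply/negP => dC.
    suff CW : C = W by have := subsetP CU v; rewrite CW memU eqxx vW => /(_ isT).
    apply: W_conn => //; first exact: subset_trans CU (subsetDl _ _).
    move=> x y xC yW xy.
    have := subsetP CU _ xC; rewrite memU => /and3P [xv xK xW].
    have xZ : x \notin Z by have := disjointFr dC xC; rewrite in_setD1 xv /= => ->.
    have yK : y \notin K.
      by apply: contra xK => yK; apply: (Kcl y); rewrite ?in_setD ?xZ // adj_sym.
    have yv : y != v.
      apply: contraTneq xy => ->; rewrite adj_sym; apply/negP => /(vnbr _ xW).
      by rewrite (negPf xZ) (negPf xK).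
    by apply: (clC x) => //; rewrite memU yv yK.
  move=> C CU C0 clC; apply/eqP; rewrite eqEsubset CU -setD_eq0; apply/negPn/negP => D0.
  have aux : closed_in (@adj G) U (U :\: C).
    move=> x y /setDP [xU xC] yU xy; rewrite in_setD yU andbT.
    by apply: contra xC => yC; apply: (clC y) => //; rewrite adj_sym.
  have h1 := meets _ CU C0 clC; have h2 := meets _ (subsetDl _ _) D0 aux.
  have /set0Pn [x xZ] : Z :\ v != set0.
    have /card_gt0P [x] : 0 < deg_in Z v by apply: leq_trans dZ.
    rewrite inE => /andP [xZ vx]; apply/set0Pn; exists x.
    by rewrite in_setD1 xZ eq_sym adj_neq.
  by have := subsetP h2 _ xZ; rewrite in_setD (subsetP h1).
apply/eqP; rewrite eqEsubset KWZ andbT; apply/subsetP => u uW; apply/negPn/negP => uK.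
have [uW' uZ] : u \in W /\ u \notin Z by move: uW; rewrite in_setD => /andP [].
have uU : u \in U by rewrite memU uK uW' !andbT; apply: contraNneq uZ => ->.
apply: (no_trunk U) => //; apply/trunkP; split=> //; first exact: subsetDl.
  apply: subset_trans ZvU; by rewrite subsetD1 rZ.
apply: deg_sum_has_core; first by apply/set0Pn; exists u.
(* Deleting [v] removes two edges of [Z] at most, lowering the excess of edges over vertices by at
   most one; the strict growth to [U] regains it. Each added vertex has degree 3 in [W], sees
   nothing in [K] and loses at most [v]. *)
have strict : deg_sum (Z :\ v) + 2 * #|U| + 2 <= deg_sum U + 2 * #|Z :\ v|.
  apply: deg_sum_grow_strict => //.
  - apply/properP; split=> //; exists u => //.
    by rewrite in_setD1 (negPf uZ) andbF.
  - have /card_gt0P [x] : 0 < deg_in Z v by apply: leq_trans dZ.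
    rewrite inE => /andP [xZ vx]; apply/set0Pn; exists x.
    by rewrite in_setD1 xZ eq_sym adj_neq.
  move=> y /setDP [yU yZ].
  have := yU; rewrite memU => /and3P [yv yK yW].
  have {}yZ : y \notin Z by move: yZ; rewrite in_setD1 yv.
  have yr : y \notin rho by apply: contra yZ; apply: (subsetP rZ).
  have : deg_in W y = 3 by rewrite W_deg // (negPf yr).
  suff h : deg_in W y <= (deg_in U y).+1 by move=> dy; rewrite dy in h.
  apply: (@leq_trans (deg_in (v |: U) y)); last first.
    by rewrite deg_in_setU1 ?memU ?eqxx //; case: adj.
  apply: subset_leq_card; apply/subsetP => z /setIdP [zW yz]; apply/setIdP; split=> //.
  rewrite in_setU1 memU zW andbT; case: eqVneq => //= zv; apply: contra yK => zK.
  by apply: (Kcl z); rewrite ?in_setD ?yZ // adj_sym.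
have exZ : 2 * #|Z| <= deg_sum Z.
  have /existsP [X /andP [XZ cX]] := hZ.
  have X0 : X != set0 by case/andP: cX.
  have h1 := deg_sum_grow cZ XZ X0; have h2 := core_deg_sum cX.
  by clear -h1 h2; lia.
have := deg_sum_setD1 vZ; have := cardsD1 v Z; rewrite vZ.
by clear -exZ strict dZ2; lia.
Qed.


Lemma exists_lollipop : exists a b l w,
  let p := [:: a, b & l] in let K := W :\: [set x in p] in
  [/\ uniq p, path (@adj G) a (b :: l), {subset p <= W}, w \in l & adj a w] /\
  [/\ rho \subset [set last b l], conn K,
      {in p &, forall x y, adj x y -> [set x; y] \in pedges p \/ [set x; y] = [set a; w]},
      (exists2 k, k \in K & adj a k) /\ (exists2 k, k \in K & adj b k) &
      rho = set0 -> w = last b l /\ exists2 k, k \in K & adj w k].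
Proof.
have [Z [K [tZ cK KZ Kmax Zmin]]] := exists_optimal.
have [a [b [l [w [up pp pZ [wl aw rl r0w]]]]]] := lollipop_path tZ Zmin.
exists a, b, l, w => /=.
have KE := optimal_complement tZ cK KZ Kmax Zmin up pp pZ wl aw rl r0w.
have [ZW _ _ _] := trunkP _ tZ.
have memp := mem_trunk pZ.
split; first by split=> // x; rewrite -memp => /(subsetP ZW).
rewrite pZ KE; split=> //.
- by move=> x y; rewrite -!memp => xZ yZ; apply: (chordless tZ Zmin up pp pZ wl aw rl).
- split; rewrite -KE.
    exact: (apex_outside tZ Zmin up pp pZ wl aw rl).
  exact: (second_outside tZ Zmin up pp pZ wl rl).
move=> r0; split; first exact: r0w.
by rewrite -KE; apply: (last_outside tZ Zmin up pp pZ wl rl (r0w r0) r0).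
Qed.

End Optimal.

End Lollipop.

(** * Colouring a lollipop *)

Section Colouring.

Variable G : sgraph.
Implicit Types (s u : seq {set G}) (e f g h t : {set G}) (x y z c d k : G).

Lemma pedges_cons2 c d l : pedges [:: c, d & l] = rcons (pedges (d :: l)) [set c; d].
Proof. by []. Qed.

Lemma pedges_sub l g x : g \in pedges l -> x \in g -> x \in l.
Proof.
elim: l => // c [|d l] IH //; rewrite [pedges _]/= mem_rcons inE => /orP [/eqP ->|gl xg].
  by rewrite !inE => /orP [] ->; rewrite ?orbT.
by rewrite inE (IH gl xg) orbT.
Qed.

Lemma pedges_consec A x y B : [set x; y] \in pedges (A ++ [:: x, y & B]).
Proof.
elim: A => [|c A IH]; first by rewrite /= mem_rcons inE eqxx.
by case: A IH => [|d A] IH; rewrite [pedges _]/= mem_rcons inE IH orbT.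
Qed.

Lemma colour_path s f r c q : greedy_ok s -> f \in s -> r \in f ->
  uniq (c :: q) -> path (@adj G) c q -> last c q = r ->
  {in s & c :: q, forall g x, x \in g -> g = f /\ x = r} ->
  let s' := s ++ pedges (c :: q) in
  [/\ greedy_ok s', {in pedges (c :: q), forall g, col s' g <= 2} &
      {in s', forall g, c \in g -> g = if q is d :: _ then [set c; d] else f}].
Proof.
move=> os fs rf; elim: q c => [|d q IH] c uq pq lq sq.
  split; rewrite //= ?cats0 // => g gs cg.
  by have [] := sq g c gs (mem_head _ _) cg.
have [ud pd cd] : [/\ uniq (d :: q), path (@adj G) d q & adj c d].
  by split; [case/andP: uq|case/andP: pq|case/andP: pq].
rewrite /= in lq.
have [|os' col2 dE] := IH d ud pd lq.
  by move=> g x gs xq; apply: sq => //; rewrite inE xq orbT.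
set s' := s ++ pedges (d :: q) in os' col2 dE *.
have cdq : c \notin d :: q by case/andP: uq.
have noc g : g \in s' -> c \notin g.
  rewrite mem_cat => /orP [gs|gq]; last by apply: contra cdq; apply: pedges_sub.
  apply: contra cdq => cg; have [_ ->] := sq g c gs (mem_head _ _) cg.
  by rewrite -lq mem_last.
have ces : [set c; d] \notin s' by apply/negP => /noc; rewrite !inE eqxx.
set h := if q is d' :: _ then [set d; d'] else f in dE.
have hs : h \in s'.
  rewrite mem_cat /h; case: (q) => [|d' q']; first by rewrite fs.
  by rewrite [pedges _]/= mem_rcons inE eqxx orbT.
have dh : d \in h by rewrite /h; move: lq; case: (q) => [|d' q'] /= => [->|_] //;
  rewrite !inE eqxx.
have ncl : ncol s' [set c; d] <= 2.
  rewrite -[2]/(1.+1) -(cards1 h); apply: ncol_le_card (greedy_ok_uniq os') _ => g gs /shareP [x].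
  rewrite !inE => /orP [] /eqP -> xg; first by rewrite (negPf (noc _ gs)) in xg.
  by rewrite (dE _ gs xg).
have okc : greedy_ok (rcons s' [set c; d]).
  apply: greedy_ok_rcons => //; first exact: edges_adj.
    apply/orP; right; apply/hasP; exists h => //.
    by apply: (shareI _ dh); rewrite !inE eqxx orbT.
  exact: leq_trans ncl _.
rewrite [pedges _]/= -rcons_cat -/s'; split=> //.
  move=> g; rewrite mem_rcons inE => /orP [/eqP ->|gq].
    by rewrite col_rcons_new ?(greedy_ok_uniq os').
  by rewrite col_rcons ?col2 // mem_cat gq orbT.
move=> g; rewrite mem_rcons inE => /orP [/eqP -> //|/noc] /negP //.
Qed.

Lemma two_colours (i j k : nat) : 0 < i <= 2 -> 0 < j <= 2 -> 0 < k <= 2 -> i != j ->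
  k = i \/ k = j.
Proof. by case: i j k => [|[|[]]] // [|[|[]]] // [|[|[]]] // _ _ _ _;
  [left|right|right|left]. Qed.

(** Prepares the closing edge [[set a; w]] as a target. If [w] is not the root, the two path edges
    at [w] bear both colours 1 and 2, one of which recurs on [[set a; b]]. If it is, [f] replaces
    one of them; when [f] has colour 3, colouring [[set b; k]] early pushes [[set a; b]] up to 3. *)
Lemma colour_lollipop s f r a b l w k : greedy_ok s -> f \in s -> r \in f -> col s f <= 3 ->
  uniq [:: a, b & l] -> path (@adj G) a (b :: l) -> last b l = r ->
  {in s & [:: a, b & l], forall g x, x \in g -> g = f /\ x = r} ->
  w \in l -> adj a w -> adj b k -> k \notin [:: a, b & l] ->
  (col s f = 3 -> {in s, forall g, k \notin g}) ->
  exists u, [/\ greedy_ok (s ++ u), {subset pedges [:: a, b & l] <= u},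
    {subset u <= [set b; k] :: pedges [:: a, b & l]} &
    exists g h, [/\ g \in s ++ u, h \in s ++ u, g != h,
      share_endpoint [set a; w] g /\ share_endpoint [set a; w] h &
      col (s ++ u) g = col (s ++ u) h]].
Proof.
move=> os fs rf cf up pp lr sp wl aw bk kp ks.
have [os1 col2 aE] := colour_path os fs rf up pp lr sp.
set p := [:: a, b & l] in sp kp os1 col2 aE *.
have ub : uniq (b :: l) by case/andP: up.
have abl : a \notin b :: l by case/andP: up.
have ap : a \in p by rewrite inE eqxx.
have bp : b \in p by rewrite !inE eqxx orbT.
have rbl : r \in b :: l by rewrite -lr mem_last.
have af : a \notin f.
  apply/negP => af; have [_ ar] := sp f a fs ap af.
  by rewrite ar rbl in abl.
have wa : w != a by apply: contraNneq abl => <-; rewrite inE wl orbT.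
have wb : w != b by apply: contraTneq ub => <-; rewrite /= wl.
have fin g h : g \in pedges p -> h \in s ++ pedges p -> h != [set a; b] ->
    g != h -> col (s ++ pedges p) h <= 2 -> w \in g -> w \in h -> g != [set a; b] ->
    exists g h, [/\ g \in s ++ pedges p, h \in s ++ pedges p, g != h,
      share_endpoint [set a; w] g /\ share_endpoint [set a; w] h &
      col (s ++ pedges p) g = col (s ++ pedges p) h].
  move=> gp hp hab gh ch wg wh gab.
  have gs : g \in s ++ pedges p by rewrite mem_cat gp orbT.
  have abp : [set a; b] \in pedges p by rewrite [pedges _]/= mem_rcons inE eqxx.
  have abs : [set a; b] \in s ++ pedges p by rewrite mem_cat abp orbT.
  have c0 e : e \in s ++ pedges p -> 0 < col (s ++ pedges p) e
    by move/(greedy_ok_col os1)/andP => [].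
  have ta : a \in [set a; w] by rewrite !inE eqxx.
  have tw : w \in [set a; w] by rewrite !inE eqxx orbT.
  have aab : a \in [set a; b] by rewrite !inE eqxx.
  have sgh : share_endpoint g h by apply: shareI wg wh.
  have c12 e : e \in s ++ pedges p -> col (s ++ pedges p) e <= 2 ->
    0 < col (s ++ pedges p) e <= 2 by move=> /c0 -> ->.
  case: (two_colours (c12 _ gs (col2 _ gp)) (c12 _ hp ch) (c12 _ abs (col2 _ abp))
    (col_proper os1 gs hp gh sgh)) => E.
    by exists [set a; b], g; split=> //; [rewrite eq_sym|split; [apply: shareI ta aab|apply: shareI tw wg]].
  by exists [set a; b], h; split=> //; [rewrite eq_sym|split; [apply: shareI ta aab|apply: shareI tw wh]].
have [l1 [l2 lE]] : exists l1 l2, l = l1 ++ w :: l2 by case/splitPr: wl => l1 l2;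
  exists l1, l2.
pose c := last b l1.
have cp : [set c; w] \in pedges p.
  rewrite /p lE -cat_cons (lastI b l1) -/c cat_rcons -cat_cons.
  exact: pedges_consec.
have cbl : c \in b :: l1 := mem_last b l1.
have ca : c != a.
  by apply: contraNneq abl => <-; move: cbl; rewrite lE !inE mem_cat => /orP [] ->;
    rewrite ?orbT.
have cw : c != w.
  apply: contraTneq ub => cE; move: cbl; rewrite cE inE (negPf wb) /= => wl1.
  by rewrite lE /= cat_uniq /= wl1 /= !andbF.
have cwab : [set c; w] != [set a; b].
  apply/negP => /eqP/setP/(_ a); rewrite !inE eqxx /= [a == c]eq_sym [a == w]eq_sym.
  by rewrite (negPf ca) (negPf wa).
have wcw : w \in [set c; w] by rewrite !inE eqxx orbT.
have [wr|wr] := eqVneq w r; last first.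
  case: l2 lE => [|d l2] lE.
    by move: wr; rewrite -lr lE last_cat eqxx.
  exists (pedges p); split=> //; first by move=> g gp; rewrite inE gp orbT.
  have wdp : [set w; d] \in pedges p by rewrite /p lE -!cat_cons; apply: pedges_consec.
  have da : d != a.
    by apply: contraNneq abl => <-; rewrite lE inE mem_cat !inE eqxx !orbT.
  have dc : d != c.
    apply: contraTneq ub => dE; rewrite lE -cat_cons cat_uniq.
    by apply/negP => /and3P [_ /hasPn /(_ d)];
      rewrite !inE eqxx orbT => /(_ isT) /negP []; rewrite dE.
  have dw : d != w.
    apply: contraTneq ub => dE; rewrite lE -cat_cons cat_uniq dE [uniq (w :: _)]/=.
    by rewrite mem_head !andbF.
  apply: (fin [set c; w] [set w; d]) => //.
  - by rewrite mem_cat wdp orbT.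
  - apply/negP => /eqP/setP/(_ a); rewrite !inE eqxx /= [a == w]eq_sym [a == d]eq_sym.
    by rewrite (negPf da) (negPf wa).
  - apply/negP => /eqP/setP/(_ d); rewrite !inE eqxx orbT.
    by rewrite (negPf dc) (negPf dw).
  - exact: col2.
  by rewrite !inE eqxx.
subst w.
have cfE u : col (s ++ u) f = col s f by rewrite col_cat.
have cnf : c \notin f.
  apply/negP => cf'; have [|_ cr] := sp f c fs _ cf'; last by rewrite cr eqxx in cw.
  by rewrite inE lE -cat_cons mem_cat cbl orbT.
have [cf2|cf2] := leqP (col s f) 2.
  exists (pedges p); split=> //; first by move=> g gp; rewrite inE gp orbT.
  apply: (fin [set c; r] f) => //.
  - by rewrite mem_cat fs.
  - by apply: contraNneq af => ->; rewrite !inE eqxx.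
  - by apply: contraNneq cnf => <-; rewrite !inE eqxx.
  by rewrite cfE.
have {cf cf2} cf3 : col s f = 3 by apply/eqP; rewrite eqn_leq cf.
have {ks} := ks cf3 => ks.
have bl : b \notin l by case/andP: ub.
have ab : adj a b by case/andP: pp.
have kb : k != b by rewrite eq_sym adj_neq.
have ka : k != a by apply: contraNneq kp => ->.
have [||os2 col22 bE] := colour_path os fs rf ub _ lr.
- by case/andP: pp.
- by move=> g x gs xl; apply: sp => //; rewrite inE xl orbT.
case lE' : l wl (bl) => [|d l'] // _ bl'.
set s2 := s ++ pedges (b :: l) in os2 col22 bE.
have bds : [set b; d] \in pedges (b :: l) by rewrite lE' [pedges _]/= mem_rcons inE eqxx.
have bds2 : [set b; d] \in s2 by rewrite mem_cat bds orbT.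
have {}bE g : g \in s2 -> b \in g -> g = [set b; d].
  by move=> gs bg; rewrite (bE g gs bg) lE'.
have nok g : g \in s2 -> k \notin g.
  rewrite mem_cat => /orP [/ks //|gp]; apply: contra kp => kg.
  by rewrite inE (pedges_sub gp kg) orbT.
have noa g : g \in s2 -> a \notin g.
  rewrite mem_cat => /orP [gs|gp]; last by apply: contra abl; apply: pedges_sub.
  by apply: contra af => ag; have [<-] := sp g a gs ap ag.
set h := [set b; k].
have hs : h \notin s2 by apply/negP => /nok; rewrite !inE eqxx orbT.
have bh : b \in h by rewrite !inE eqxx.
have bd : b \in [set b; d] by rewrite !inE eqxx.
have hbd : share_endpoint h [set b; d] by apply: shareI bh bd.
(* No coloured edge meets [k], so [[set b; d]] alone constrains [h]. *)
have nch : ncol s2 h <= 2.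
  rewrite -[2]/(1.+1) -(cards1 [set b; d]);
    apply: ncol_le_card (greedy_ok_uniq os2) _ => g gs /shareP [x].
  rewrite !inE => /orP [] /eqP -> xg; last by rewrite (negPf (nok _ gs)) in xg.
  by rewrite (bE g).
have os3 : greedy_ok (rcons s2 h).
  apply: greedy_ok_rcons => //; first exact: edges_adj; last exact: leq_trans nch _.
  by apply/orP; right; apply/hasP; exists [set b; d].
set e0 := [set a; b].
have ae0 : a \in e0 by rewrite !inE eqxx.
have be0 : b \in e0 by rewrite !inE eqxx orbT.
have ah : a \notin h by rewrite !inE negb_or eq_sym [a == k]eq_sym ka andbT;
  apply: contraNneq abl => ->; rewrite inE eqxx.
have noa3 g : g \in rcons s2 h -> a \notin g.
  by rewrite mem_rcons inE => /orP [/eqP -> //|/noa].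
have es3 : e0 \notin rcons s2 h by apply/negP => /noa3; rewrite ae0.
have hs3 : h \in rcons s2 h by rewrite mem_rcons inE eqxx.
have bds3 : [set b; d] \in rcons s2 h by rewrite mem_rcons inE bds2 orbT.
have hbd' : h != [set b; d] by apply: contraNneq hs => ->.
have nce : ncol (rcons s2 h) e0 <= 3.
  have c2 : #|[set h; [set b; d]]| = 2 by rewrite cards2 hbd'.
  rewrite -[3]/(2.+1) -c2; apply: ncol_le_card (greedy_ok_uniq os3) _ => g gs /shareP [x].
  rewrite [x \in e0]in_set2 => /orP [] /eqP -> xg;
    first by rewrite (negPf (noa3 _ gs)) in xg.
  by move: gs; rewrite mem_rcons inE in_set2 => /orP [-> //|/bE ->] //; rewrite eqxx orbT.
have ne1 := ncol_neq hs3 (shareI be0 bh).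
have ne2 := ncol_neq bds3 (shareI be0 bd).
have chE : col (rcons s2 h) h = ncol s2 h by rewrite col_rcons_new // greedy_ok_uniq.
(* Colours 1 and 2 are both present at [b], and no coloured edge is at [a]. *)
have nc3 : ncol (rcons s2 h) e0 = 3.
  have hbdc : col (rcons s2 h) h != col (rcons s2 h) [set b; d] by apply: col_proper.
  have [c1 _] := andP (greedy_ok_col os3 hs3);
    have [c2 _] := andP (greedy_ok_col os3 bds3).
  have c3 : 0 < ncol (rcons s2 h) e0 by apply: smallest_free_gt0.
  have d2 : col (rcons s2 h) [set b; d] <= 2 by rewrite col_rcons // col22.
  have d1 : col (rcons s2 h) h <= 2 by rewrite chE.
  move: nce ne1 ne2 hbdc c1 c2 c3 d1 d2.
  move: (ncol (rcons s2 h) e0) (col (rcons s2 h) h) (col (rcons s2 h) [set b; d]) => i j m.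
  by case: i j m => [|[|[|[|i]]]] // [|[|[|j]]] // [|[|[|m]]].
have os4 : greedy_ok (rcons (rcons s2 h) e0).
  apply: greedy_ok_rcons => //; rewrite ?nc3 //; first exact: edges_adj.
  by apply/orP; right; apply/hasP; exists h => //; apply: shareI be0 bh.
have uE : rcons (rcons s2 h) e0 = s ++ rcons (rcons (pedges (b :: l)) h) e0.
  by rewrite -!rcons_cat.
exists (rcons (rcons (pedges (b :: l)) h) e0); rewrite -uE; split=> //.
- move=> g; rewrite pedges_cons2 !mem_rcons inE !in_cons mem_rcons in_cons.
  by case/orP => ->; rewrite ?orbT.
- move=> g; rewrite /p pedges_cons2 in_cons !mem_rcons !in_cons mem_rcons in_cons.
  by case/or3P => ->; rewrite ?orbT.
exists e0, f; split.
- by rewrite mem_rcons inE eqxx.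
- by rewrite uE mem_cat fs.
- by apply: contraNneq af => <-.
- by split; [apply: (shareI _ ae0)|apply: (shareI _ rf)]; rewrite !inE eqxx ?orbT.
by rewrite col_rcons_new ?(greedy_ok_uniq os3) // nc3 uE cfE cf3.
Qed.

End Colouring.

(** * Subcubic graphs *)

Section Main.

Variable G : sgraph.
Hypothesis subcubic : forall x : G, degree x <= 3.
Implicit Types (s u : seq {set G}) (e f g h t : {set G}) (x y z c d k : G).
Implicit Types (R Q : {set {set G}}).

Notation share := (@share_endpoint G).
Notation conn_L := (conn share).
Notation conn_G := (conn (@adj G)).

(** With the lollipop coloured, its closing edge [t] becomes the target. The uncoloured edges
    inherit connectedness from [K]: by the absence of chords each one other than [t] has an endpoint
    in [K], and [t] is attached through [[set a; ka]]. *)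
Lemma extend_lollipop n s R f r (W : {set G}) a b l w ka kb :
  let p := [:: a, b & l] in let K := W :\: [set x in p] in
  hanging_extension G n -> #|R| <= n.+1 -> greedy_ok s -> R \subset edges G ->
  {in R, forall g, g \notin s} -> f \in s -> col s f <= 3 -> r \in f ->
  (forall g x, g \in R -> x \in g -> x \in W) ->
  (forall g x, g \in edges G -> x \in g -> x \in W -> g \in R \/ g = f) ->
  {in p, forall x, x \in f -> x = r} ->
  uniq p -> path (@adj G) a (b :: l) -> last b l = r -> {subset p <= W} ->
  w \in l -> adj a w -> conn_G K ->
  {in p &, forall x y, adj x y -> [set x; y] \in pedges p \/ [set x; y] = [set a; w]} ->
  ka \in K -> adj a ka -> kb \in K -> adj b kb -> (col s f = 3 -> kb \notin f) ->
  exists2 u : seq {set G}, u =i R & greedy_ok (s ++ u).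
Proof.
move=> p K HF Rn os RE Rs fs cf rf RW WR fp up pp lr pW wl aw cK chord kaK aka kbK bkb kbf.
have memK x : (x \in K) = (x \notin p) && (x \in W) by rewrite in_setD in_set.
have ap : a \in p by rewrite inE eqxx.
have bp : b \in p by rewrite !inE eqxx orbT.
have wp : w \in p by rewrite !inE wl !orbT.
have rbl : r \in b :: l by rewrite -lr mem_last.
have abl : a \notin b :: l by case/andP: up.
have bl : b \notin l by case/and3P: up.
have sW g x : g \in s -> x \in g -> x \in W -> g = f.
  by move=> gs xg xW; case: (WR g x (greedy_ok_edges os gs) xg xW) => // /Rs; rewrite gs.
have sp : {in s & p, forall g x, x \in g -> g = f /\ x = r}.
  move=> g x gs xp xg; have gf := sW g x gs xg (pW _ xp); split=> //.
  by apply: fp => //; rewrite -gf.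
have af : a \notin f.
  by apply: contra abl => /(fp a ap) ->.
have bf : b \notin f.
  apply: contra bl => /(fp b bp) bE; rewrite bE -lr.
  by case: (l) wl => //= d l' _; apply: mem_last.
have RI g x : g \in edges G -> x \in g -> x \in W -> g != f -> g \in R.
  by move=> gE xg xW gf; case: (WR g x gE xg xW) => // gE'; rewrite gE' eqxx in gf.
have [kap kaW] := andP (etrans (esym (memK ka)) kaK).
have [kbp kbW] := andP (etrans (esym (memK kb)) kbK).
have [|u [ou pu up' [g1 [g2 [g1u g2u g12 [tg1 tg2] cE]]]]] :=
  colour_lollipop os fs rf cf up pp lr sp wl aw bkb kbp.
  move=> c3 g gs; apply/negP => kg; case/negP: (kbf c3).
  by rewrite -(sW g kb).
rewrite -/p in pu up'.
set t := [set a; w] in tg1 tg2 chord.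
have at_ : a \in t by rewrite !inE eqxx.
have wa : w != a by apply: contraNneq abl => <-; rewrite inE wl orbT.
have wb : w != b by apply: contraNneq bl => <-.
have ka_a : ka != a by apply: contraNneq kap => ->.
have kb_a : kb != a by apply: contraNneq kbp => ->.
have ab : a != b by apply: contraNneq abl => ->; rewrite inE eqxx.
have abkb : a \notin [set b; kb] by rewrite !inE negb_or ab eq_sym.
have tp : t \notin pedges p.
  rewrite /p pedges_cons2 mem_rcons inE negb_or; apply/andP; split.
    apply/negP => /eqP/setP/(_ w); rewrite !inE eqxx orbT.
    by rewrite (negPf wa) (negPf wb).
  by apply: contra abl => /pedges_sub; apply.
have tu : t \notin u.
  apply/negP => /up'; rewrite inE (negPf tp) orbF => /eqP tE.
  by rewrite -tE at_ in abkb.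
have tE : t \in edges G by apply: edges_adj.
have tR : t \in R by apply: (RI t a) => //; [apply: pW|apply: contraNneq af => <-].
pose R2 := R :\: [set g in u].
have memR2 g : (g \in R2) = (g \notin u) && (g \in R) by rewrite in_setD in_set.
have tR2 : t \in R2 by rewrite memR2 tu.
have pR : {subset pedges p <= R}.
  move=> g gp; have [x xg] : exists x, x \in g.
    move: gp; rewrite /p; elim: (a :: b :: l) => // c [|d q] IH //.
    rewrite pedges_cons2 mem_rcons inE => /orP [/eqP ->|/IH //].
    by exists c; rewrite !inE eqxx.
  have gs : g \in s ++ u by rewrite mem_cat pu ?orbT.
  apply: (RI g x) => //; first exact: greedy_ok_edges gs.
    exact/pW/(pedges_sub gp xg).
  have := greedy_ok_uniq ou; rewrite cat_uniq => /and3P [_ /hasPn h _].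
  by apply: contraTneq (h _ (pu _ gp)) => ->; rewrite negbK.
have uR : {subset u <= R}.
  move=> g /up'; rewrite inE => /orP [/eqP ->|/pR //].
  apply: (RI _ b); [exact: edges_adj|by rewrite !inE eqxx|exact: pW|].
  by apply: contraNneq bf => <-; rewrite !inE eqxx.
have gaR2 : [set a; ka] \in R2.
  rewrite memR2; apply/andP; split; last first.
    apply: (RI _ a); [exact: edges_adj|by rewrite !inE eqxx|exact: pW|].
    by apply: contraNneq af => <-; rewrite !inE eqxx.
  apply/negP => /up'; rewrite inE => /orP [/eqP E|gp].
    by move: abkb; rewrite -E !inE eqxx.
  by case/negP: kap; apply: (pedges_sub gp); rewrite !inE eqxx orbT.
have endK g : g \in R2 -> g != t -> exists2 x, x \in g & x \in K.
  rewrite memR2 => /andP [gu gR] gt.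
  have gE := subsetP RE _ gR; have [x [y [xy gxy]]] := edgesP _ gE.
  have xg : x \in g by rewrite gxy !inE eqxx.
  have yg : y \in g by rewrite gxy !inE eqxx orbT.
  have [xK|xK] := boolP (x \in K); first by exists x.
  have [yK|yK] := boolP (y \in K); first by exists y.
  have xp : x \in p by move: xK; rewrite memK (RW g x) // andbT negbK.
  have yp : y \in p by move: yK; rewrite memK (RW g y) // andbT negbK.
  case: (chord x y xp yp xy); rewrite -gxy; first by move/pu; rewrite (negPf gu).
  by move=> gE'; rewrite gE' eqxx in gt.
have cR2 : conn_L R2.
  move=> B BR2 /set0Pn [g0 g0B] clB.
  (* The vertices of [K] covered by [B] form a closed set, hence all of [K]. *)
  pose KB := [set z in K | [exists g in B, z \in g]].
  have KBI z g : z \in K -> z \in g -> g \in B -> z \in KB.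
    by move=> zK zg gB; rewrite inE zK; apply/exists_inP; exists g.
  have KBE : KB = K.
    apply: cK.
    - by apply/subsetP => z; rewrite inE => /andP [].
    - have [g0t|g0t] := eqVneq g0 t; last first.
        have [z zg zK] := endK _ (subsetP BR2 _ g0B) g0t.
        by apply/set0Pn; exists z; apply: KBI zK zg g0B.
      apply/set0Pn; exists ka; apply: (KBI _ [set a; ka]) => //.
        by rewrite !inE eqxx orbT.
      apply: (clB g0) => //; rewrite g0t; apply: (shareI at_).
      by rewrite !inE eqxx.
    move=> z z'; rewrite inE => /andP [zK /exists_inP [g gB zg]] z'K zz'.
    have [zp zW] := andP (etrans (esym (memK z)) zK).
    have [z'p z'W] := andP (etrans (esym (memK z')) z'K).
    have zzE := edges_adj zz'.
    have zzR2 : [set z; z'] \in R2.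
      rewrite memR2; apply/andP; split.
        apply/negP => /up'; rewrite inE => /orP [/eqP E|gp].
          have : b \in [set z; z'] by rewrite E !inE eqxx.
          by rewrite !inE => /orP [] /eqP bE; [move: zp|move: z'p]; rewrite -bE bp.
        by case/negP: zp; apply: (pedges_sub gp); rewrite !inE eqxx.
      apply: (RI _ z) => //; first by rewrite !inE eqxx.
      apply/negP => /eqP E; move: rf; rewrite -E !inE => /orP [] /eqP rE.
        by case/negP: zp; rewrite -rE inE rbl orbT.
      by case/negP: z'p; rewrite -rE inE rbl orbT.
    apply: (KBI _ [set z; z']) => //; first by rewrite !inE eqxx orbT.
    by apply: (clB g) => //; apply: (shareI zg); rewrite !inE eqxx.
  have inB g z : g \in R2 -> z \in g -> z \in K -> g \in B.
    move=> gR2 zg; rewrite -KBE inE => /andP [_ /exists_inP [h hB zh]].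
    by apply: (clB h) => //; apply: shareI zh zg.
  have gaB : [set a; ka] \in B by apply: (inB _ ka) => //; rewrite !inE eqxx orbT.
  apply/eqP; rewrite eqEsubset BR2; apply/subsetP => g gR2.
  have [->|gt] := eqVneq g t; last by have [z zg zK] := endK g gR2 gt; apply: inB zK.
  apply: (clB [set a; ka]) => //; apply: (shareI _ at_).
  by rewrite !inE eqxx.
have [|||||||||v vE ov] := @extend_to_target _ subcubic n (s ++ u) R2 t HF.
- by apply: leq_trans Rn; apply/subset_leq_card/subsetDl.
- exact: ou.
- exact: subset_trans (subsetDl _ _) RE.
- by move=> g; rewrite memR2 => /andP [gu gR]; rewrite mem_cat negb_or Rs.
- exact: cR2.
- exact: tR2.
- by exists t => //; apply/orP; right; apply/hasP; exists g1.
- move=> g; rewrite memR2 => /andP [gu gR] gt h /nbrP [hE hg /shareP [z zg zh]].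
  change ((h \in R2) || (h \in s ++ u)); rewrite memR2 mem_cat.
  case: (WR h z hE zh (RW _ _ gR zg)) => [->|->]; last by rewrite fs !orbT.
  by case: (h \in u); rewrite ?orbT.
- move=> v vR2 ov; apply: leq_trans (card_nbr_le4 subcubic tE).
  apply: (@ncol_le_same _ _ _ g1 g2) => //.
  + rewrite !mem_cat !negb_or tu (Rs _ tR) /=.
    by apply/negP => /vR2; rewrite !inE eqxx.
  + by rewrite mem_cat g1u.
  + by rewrite mem_cat g2u.
  by rewrite (col_cat v g1u) (col_cat v g2u).
exists (u ++ v); last by rewrite catA.
move=> g; rewrite mem_cat vE memR2.
by have [/uR ->|] := boolP (g \in u).
Qed.

(** * Bridges and cubic vertices *)

Lemma deg_in_setT x : deg_in setT x = degree x.
Proof. by apply: eq_card => y; rewrite !inE. Qed.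

(** The only edge [e] from [M] to [v] is a bridge, and the walk from [e0] cannot leave [M] without
    it. The edge [e0] exists because the endpoint of [e] in [M] has degree 3. *)
Lemma cut_component R (W M : {set G}) v : conn_G W -> R \subset edges G ->
  M \subset W -> M != set0 -> v \in W :\: M ->
  (forall x y, x \in M -> y \in W :\: M -> adj x y -> y = v) -> deg_in M v <= 1 ->
  {in M, forall x, degree x = 3} ->
  (forall x y, x \in M -> adj x y -> y \in W /\ [set x; y] \in R) ->
  (forall g x, g \in R -> x \in g -> x \in W) ->
  exists e e0, [/\ e \in R, e0 \in R :\ e, v \in e &
    {in component share (R :\ e) e0, forall g, g \subset M}].
Proof.
move=> cW RE MW M0 /setDP [vW vM] bd dv d3 MR RW.
have [|x [y [xM yW xy]]] := conn_crossing cW MW M0.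
  by apply: contraNneq vM => ->.
have yv : y = v by apply: bd xy.
rewrite {}yv in xy yW.
have [_ eR] := MR x v xM xy.
have [y' y'v xy'] : exists2 y', y' \in setT :\: [set v] & adj x y'.
  by apply: deg_in_nbr; rewrite cards1 deg_in_setT d3.
have {}y'v : y' != v by move: y'v; rewrite !inE andbT.
have [y'W e0R] := MR x y' xM xy'.
have y'M : y' \in M.
  apply: contraNT y'v => y'M; apply/eqP; apply: (bd x) => //.
  by rewrite inE y'M.
have e0R' : [set x; y'] \in R :\ [set x; v].
  rewrite in_setD1 e0R andbT; apply/negP => /eqP/setP/(_ y').
  by rewrite !inE eqxx orbT (negPf y'v) eq_sym (negPf (adj_neq xy')).
exists [set x; v], [set x; y']; split=> //; first by rewrite !inE eqxx orbT.
pose MQ := [set g in R :\ [set x; v] | g \subset M].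
suff sub : component share (R :\ [set x; v]) [set x; y'] \subset MQ.
  by move=> g /(subsetP sub); rewrite inE => /andP [].
apply: (@conn_sub _ _ _ _ _ [set x; y'] (component_conn (@share_sym G) e0R') (component_sub _ _ _)).
- move=> g h; rewrite !in_set => /andP [_ gM] /andP [hx hR] /shareP [z zg zh].
  rewrite hx hR /=; have zM := subsetP gM _ zg.
  have [z' zz' hE] := edges_at (subsetP RE _ hR) zh.
  have z'W : z' \in W by apply: (RW h) => //; rewrite hE !inE eqxx orbT.
  rewrite hE subUset !sub1set zM /=; apply/negPn/negP => z'M.
  have z'v : z' = v by apply: (bd z) => //; rewrite inE z'M.
  have zx : z != x by apply: contraNneq hx => <-; rewrite in_set1 hE z'v.
  suff : 1 < deg_in M v by rewrite ltnNge dv.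
  by apply: (@deg_in_gt1 _ _ _ z x) => //; rewrite adj_sym // -z'v.
- by apply/setIdP; split; [exact: e0R'|rewrite subUset !sub1set xM y'M].
exact: component_refl.
Qed.

(** Each endpoint accounts for at most two neighbours, so four of them need two at each end. *)
Lemma nbr_gt3_degree x y : adj x y -> 3 < #|nbr [set x; y]| -> degree x = 3.
Proof.
move=> xy lt; have := leq_trans lt (card_nbr xy).
move: (subcubic x) (subcubic y); clear.
by case: (degree x) => [|[|[|[|]]]] // _; case: (degree y) => [|[|[|[|]]]].
Qed.

(** Once [R] is connected, without an edge having at most three neighbours and without a bridge to a
    piece away from [f], the vertices it covers satisfy the hypotheses of the lollipop construction
    with [f] as root edge. The inner induction serves to split off components of [R]. *)
Lemma hanging n : hanging_extension G n.
Proof.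
elim: n => [|n IH] s R f x0.
  rewrite leqn0 cards_eq0 => /eqP -> os *; exists [::]; rewrite ?cats0 //.
  by move=> g; rewrite in_set0.
have [m] := ubnP #|R|; elim: m s R => // m IHm s R.
rewrite ltnS => Rm Rn os RE Rs fs cf x0f Rx0 RN Rc.
have [->|/set0Pn [e1 e1R]] := eqVneq R set0.
  by exists [::]; rewrite ?cats0 // => g; rewrite in_set0.
pose Q1 := component share R e1.
have Q1R : Q1 \subset R := component_sub _ _ _.
have e1Q1 : e1 \in Q1 := component_refl _ e1R.
have cQ1 : conn_L Q1 := component_conn (@share_sym G) e1R.
have [Q1E|Q1n] := eqVneq Q1 R; last first.
  have Q1p : Q1 \proper R by rewrite properEneq Q1n.
  have sub_case Q s' : Q \proper R -> closed_in share R Q -> greedy_ok s' -> f \in s' ->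
      col s' f <= 3 -> {in Q, forall g, g \notin s'} ->
      (forall e, e \in Q -> component share R e \subset component share Q e) ->
      exists2 u : seq {set G}, u =i Q & greedy_ok (s' ++ u).
    move=> Qp clQ os' fs' cf' Qs' Qc; have QR := proper_sub Qp.
    apply: IHm => //.
    - exact: leq_trans (proper_card Qp) Rm.
    - exact: leq_trans (ltnW (proper_card Qp)) Rn.
    - exact: subset_trans QR RE.
    - by move=> g /(subsetP QR) /Rx0.
    - move=> g gQ; apply/subsetP => h hN; have gR := subsetP QR _ gQ.
      have := subsetP (RN _ gR) _ hN; rewrite !in_setU1 => /orP [-> //|hR].
      by case/nbrP: hN => _ _ gh; rewrite (clQ g h) ?orbT.
    move=> g gQ; have [h hc hf] := Rc _ (subsetP QR _ gQ).
    by exists h => //; apply: (subsetP (Qc _ gQ)).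
  have comp_sub Q e : closed_in share R Q -> Q \subset R -> e \in Q ->
      component share R e \subset component share Q e.
    move=> clQ QR eQ; have eR := subsetP QR _ eQ.
    have cc := component_conn (@share_sym G) eR.
    apply: sub_component => //; last exact: component_refl.
    exact: (conn_sub cc (component_sub _ _ _) clQ eQ (component_refl _ eR)).
  have [|||u uE ou] := sub_case Q1 s Q1p _ os fs cf.
  - exact: component_closed.
  - by move=> g /(subsetP Q1R) /Rs.
  - by move=> e; apply: comp_sub => //; apply: component_closed.
  have clC : closed_in share R (R :\: Q1) by apply: component_closedC; apply: share_sym.
  have [|||||v vE ov] := sub_case (R :\: Q1) (s ++ u) _ clC ou.
  - apply/properP; split; first exact: subsetDl.
    by exists e1 => //; rewrite in_setD e1Q1.
  - by rewrite mem_cat fs.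
  - by rewrite col_cat.
  - move=> g /setDP [gR gQ]; rewrite mem_cat negb_or Rs //= uE.
    exact: gQ.
  - by move=> e; apply: comp_sub; rewrite ?subsetDl.
  exists (u ++ v); last by rewrite catA.
  move=> g; rewrite mem_cat uE vE in_setD.
  by have [gQ|] := boolP (g \in Q1); rewrite ?orbF //= (subsetP Q1R).
have cR : conn_L R by rewrite -Q1E.
have {Q1 Q1R e1Q1 cQ1 Q1E} [z zR zf] : exists2 z, z \in R & share z f.
  by have [z zc zf] := Rc _ e1R; exists z => //;
    apply: (subsetP (component_sub _ _ _) _ zc).
have RsN : {in R, forall g, {subset nbr g <= [predU R & s]}}.
  move=> g gR h /(subsetP (RN _ gR)); rewrite in_setU1 => /orP [/eqP ->|hR].
    by apply/orP; right.
  by apply/orP; left.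
have zst : startable s z by apply/orP; right; apply/hasP; exists f.
have [/exists_inP [t tR ct]|noA] := boolP [exists t in R, #|nbr t| <= 3].
  apply: (@extend_to_target _ subcubic n s R t IH) => //.
  - by exists z.
  - by move=> g gR _; apply: RsN.
  move=> u uR ou; apply: leq_trans (_ : #|nbr t|.+1 <= 4); last by [].
  apply: ncol_le_card (greedy_ok_uniq ou) _ => g gs tg; apply/nbrP; split=> //.
    exact: greedy_ok_edges gs.
  apply: contraTneq gs => ->; rewrite mem_cat negb_or Rs //=.
  by apply/negP => /uR; rewrite !inE eqxx.
have [/exists_inP [e eR /exists_inP [e0 e0R /forall_inP Qf]]|noA'] := boolP
    [exists e in R, exists e0 in R :\ e,
      [forall g in component share (R :\ e) e0, ~~ share g f]].
  have zQ : z \notin component share (R :\ e) e0.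
    by apply/negP => /Qf; rewrite zf.
  have fQ : f \notin component share (R :\ e) e0.
    apply/negP => /(subsetP (component_sub _ _ _)); rewrite in_setD1 => /andP [_ /Rs].
    by rewrite fs.
  apply: (@extend_across_cut _ subcubic n s R e e0 IH) => //.
  - move=> g h gQ hs; apply/negP => gh.
    have /setD1P [_ gR] := subsetP (component_sub _ _ _) _ gQ.
    have hN : h \in nbr g.
      apply/nbrP; split=> //; first exact: greedy_ok_edges hs.
      by apply: contraTneq hs => ->; apply: Rs.
    have := subsetP (RN _ gR) _ hN; rewrite in_setU1 => /orP [/eqP hf|/Rs].
      by have := Qf _ gQ; rewrite -hf gh.
    by rewrite hs.
  (* The neighbour of [e] beyond [Q] is [f] if [e] is the edge [z] touching [f], and otherwise comes
     from the connectedness of [R] without [Q]. *)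
  - have [zE|ze] := eqVneq z e.
      exists f => //; apply/nbrP; split; first exact: greedy_ok_edges fs.
        by apply: contraTneq fs => ->; apply: Rs.
      by rewrite -zE.
    have cRQ := conn_setD_component (@share_sym G) (x := e0) cR eR.
    have eQ : e \notin component share (R :\ e) e0.
      by apply/negP => /(subsetP (component_sub _ _ _)); rewrite !inE eqxx.
    have [||| y /setD1P [ye /setDP [yR yQ]] ey] := conn_nbr cRQ (x := e) (y := z).
    + by rewrite in_setD eQ.
    + by rewrite in_setD zQ.
    + by rewrite eq_sym.
    by exists y => //; apply/nbrP; split=> //; apply: (subsetP RE).
  by exists z => //; rewrite in_setD zQ.
have [r x0r fE] := edges_at (greedy_ok_edges os fs) x0f.
have rf : r \in f by rewrite fE !inE eqxx orbT.
pose W := [set x | [exists g in R, x \in g]].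
have RW g x : g \in R -> x \in g -> x \in W.
  by move=> gR xg; rewrite inE; apply/exists_inP; exists g.
have WP x : x \in W -> exists2 g, g \in R & x \in g by rewrite inE => /exists_inP.
have x0W : x0 \notin W by apply/negP => /WP [g /Rx0/negP].
have WR g x : g \in edges G -> x \in g -> x \in W -> g \in R \/ g = f.
  move=> gE xg /WP [h hR xh]; have [->|gh] := eqVneq g h; first by left.
  have : g \in nbr h by apply/nbrP; split=> //; apply: shareI xh xg.
  by move/(subsetP (RN _ hR)); rewrite in_setU1 => /orP [/eqP|]; [right|left].
have fW x : x \in f -> x \in W -> x = r.
  by rewrite fE => /set2P [] -> //; rewrite (negPf x0W).
have d3 : {in W, forall x, degree x = 3}.
  move=> x /WP [g gR xg]; have [y xy gE] := edges_at (subsetP RE _ gR) xg.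
  apply: (nbr_gt3_degree xy); rewrite -gE ltnNge; apply: contra noA => cg.
  by apply/exists_inP; exists g.
have Wadj x y : x \in W -> x != r -> adj x y -> y \in W /\ [set x; y] \in R.
  move=> xW xr xy; have xxy : x \in [set x; y] by rewrite !inE eqxx.
  have [xyR|xyf] := WR _ x (edges_adj xy) xxy xW.
    by split=> //; apply: (RW _ y xyR); rewrite !inE eqxx orbT.
  by case/eqP: xr; apply: fW; rewrite // -xyf.
have rW : r \in W.
  have /shareP [y yz] := zf; rewrite fE => /set2P [] yE; rewrite yE in yz.
    by rewrite (negPf (Rx0 _ zR)) in yz.
  exact: (RW z).
have cW : conn_G W.
  move=> B BW /set0Pn [b bB] clB.
  have stepB g x y : g \in R -> x \in g -> y \in g -> x \in B -> y \in B.
    move=> gR xg yg xB; have [->//|yx] := eqVneq y x.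
    rewrite eq_sym in yx; have [_ xy] := edge_eq_set2 (subsetP RE _ gR) xg yg yx.
    exact: (clB x) (RW g y gR yg) xy.
  pose RB := [set g in R | [exists x in B, x \in g]].
  have RBE : RB = R.
    apply: cR.
    - by apply/subsetP => g; rewrite inE => /andP [].
    - have [g gR bg] := WP _ (subsetP BW _ bB); apply/set0Pn; exists g.
      by rewrite inE gR; apply/exists_inP; exists b.
    move=> g h; rewrite !in_set => /andP [gR /exists_inP [x xB xg]] hR /shareP [y yg yh].
    by rewrite hR; apply/exists_inP; exists y => //; apply: (stepB g x).
  apply/eqP; rewrite eqEsubset BW; apply/subsetP => x /WP [g]; rewrite -RBE.
  by rewrite inE => /andP [gR /exists_inP [y yB yg]] xg; apply: (stepB g y).
(* The root alone lacks a neighbour in [W], namely [x0]. *)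
have Wdg : {in W, forall x, deg_in W x = 3 - (x \in [set r])}.
  move=> x xW; rewrite in_set1 -(d3 x xW); have [xr|xr] := eqVneq x r; last first.
    rewrite subn0; apply: eq_card => y; rewrite [RHS]in_set.
    by apply/setIdP/idP => [[] //|xy]; have [] := Wadj x y xW xr xy.
  rewrite subn1 /degree (cardsD1 x0) in_set xr adj_sym x0r /=.
  apply: eq_card => y; apply/setIdP/setD1P => [[yW ry]|[yx0]].
    by rewrite in_set; split=> //; apply: contraNneq x0W => <-.
  rewrite in_set => ry; split=> //.
  have rry : r \in [set r; y] by rewrite !inE eqxx.
  have [ryR|ryf] := WR _ r (edges_adj ry) rry rW.
    by apply: (RW _ y ryR); rewrite !inE eqxx orbT.
  have : x0 \in [set r; y] by rewrite ryf.
  by rewrite !inE [x0 == y]eq_sym (negPf yx0) (negPf (adj_neq x0r)).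
(* Such a cut would give a bridge to a piece that misses [r], hence [f]. *)
have Wcut (M : {set G}) v : M \subset W :\: [set r] -> M != set0 -> v \in W :\: M ->
    (forall x y, x \in M -> y \in W :\: M -> adj x y -> y = v) -> deg_in M v <= 1 -> False.
  move=> MW M0 vW bd dv.
  have MW' x : x \in M -> x != r /\ x \in W by move/(subsetP MW)/setD1P.
  have [|||e [e0 [eR e0R _ eM]]] := cut_component cW RE _ M0 vW bd dv _ _ RW.
  - by apply/subsetP => x /MW' [].
  - by move=> x /MW' [_ /d3].
  - by move=> x y /MW' [xr xW]; apply: Wadj.
  case/exists_inP: noA'; exists e => //; apply/exists_inP; exists e0 => //.
  apply/forall_inP => g /eM gM; apply/negP => /shareP [x /(subsetP gM) /MW' [xr xW]].
  by move=> xf; case/eqP: xr; apply: fW.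
have [|||a [b [l [w [[up pp pW wl aw] [rl cK chord [[ka kaK aka] [kb kbK bkb]] _]]]]]] :=
  exists_lollipop cW _ _ _ Wdg Wcut.
- by apply/set0Pn; exists r.
- by rewrite sub1set.
- by rewrite cards1.
have lr : last b l = r by apply/esym/set1P; apply: (subsetP rl); rewrite inE.
apply: (@extend_lollipop n s R f r W a b l w ka kb) => //.
  by move=> x xp xf; apply: fW => //; apply: pW.
(* [f] meets [W] only in [r], which is on the path, whereas [kb] is off it. *)
move=> _; apply/negP => kf; move: kbK; rewrite !in_setD in_set => /andP [kp kW].
by case/negP: kp; rewrite (fW kb kf kW) -lr inE mem_last orbT.
Qed.

Lemma connected_graph_conn : connected_graph G -> conn_G [set: G].
Proof.
case/andP=> _ /forallP hC B _ /set0Pn [x xB] clB; apply/eqP; rewrite -subTset.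
apply/subsetP => y _; have cl : closed (@adj G) (mem B).
  apply: intro_closed; first by apply: sym_connect_sym; apply: adj_sym.
  by move=> u v uv uB; apply: (clB u) uv.
by rewrite -(closed_connect cl (x := x)) //; apply: (forallP (hC x)).
Qed.

Lemma edges_conn : connected_graph G -> conn_L (edges G).
Proof.
move=> hG B BE /set0Pn [e eB] clB; have cG := connected_graph_conn hG.
have ne g : g \in edges G -> exists x, x \in g.
  by case/edgesP=> x [y [_ ->]]; exists x; rewrite !inE eqxx.
have VE : [set x | [exists g in B, x \in g]] = setT.
  apply: cG; rewrite ?subsetT //.
    have [x xe] := ne _ (subsetP BE _ eB).
    by apply/set0Pn; exists x; rewrite inE; apply/exists_inP; exists e.
  move=> x y; rewrite !in_set => /exists_inP [g gB xg] _ xy.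
  apply/exists_inP; exists [set x; y]; last by rewrite !inE eqxx orbT.
  apply: (clB g) => //; first exact: edges_adj.
  by apply: (shareI xg); rewrite !inE eqxx.
apply/eqP; rewrite eqEsubset BE; apply/subsetP => g gE; have [x xg] := ne _ gE.
have : x \in [set: G] by rewrite inE.
rewrite -VE inE => /exists_inP [h hB xh].
by apply: (clB h) => //; apply: shareI xh xg.
Qed.

(** The cases are those of [hanging], without a root edge. In the cubic bridgeless case the lollipop
    is a bare cycle, and an edge leaving it at [w] is coloured first to play the root edge. *)
Lemma exists_greedy_ok : connected_graph G -> exists2 s, s =i edges G & greedy_ok s.
Proof.
move=> hG; have cG := connected_graph_conn hG; have cE := edges_conn hG.
have E_E : edges G \subset edges G by [].
have nilN : {in edges G, forall e, {subset nbr e <= [predU edges G & [::]]}}.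
  by move=> e _ g /nbrP [gE _ _]; apply/orP; left.
have [/exists_inP [t tE ct]|noA] := boolP [exists t in edges G, #|nbr t| <= 3].
  apply: (@extend_to_target _ subcubic #|edges G| [::] (edges G) t (@hanging _)) => //.
  - exact: greedy_ok_nil.
  - by exists t.
  - by move=> e eE _; apply: nilN.
  move=> u uE ou; apply: leq_trans (_ : #|nbr t|.+1 <= 4); last by [].
  apply: ncol_le_card (greedy_ok_uniq ou) _ => g gs tg; apply/nbrP; split=> //.
    exact: greedy_ok_edges gs.
  by apply: contraTneq gs => ->; apply/negP => /uE; rewrite !inE eqxx.
(* Nothing is coloured yet, so any edge whose removal disconnects the remaining edges will do. *)
have [/exists_inP [e eE /exists_inP [e0 e0E]]|noA'] := boolP
    [exists e in edges G, exists e0 in edges G :\ e,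
      component share (edges G :\ e) e0 != edges G :\ e].
  rewrite eqEsubset component_sub => /subsetPn [y /setD1P [ye yE] yQ].
  apply: (@extend_across_cut _ subcubic #|edges G| [::] (edges G) e e0 (@hanging _)) => //.
  - exact: greedy_ok_nil.
  - have cRQ := conn_setD_component (@share_sym G) (x := e0) cE eE.
    have eQ : e \notin component share (edges G :\ e) e0.
      by apply/negP => /(subsetP (component_sub _ _ _)); rewrite !inE eqxx.
    have [||| z /setD1P [ze /setDP [zR zQ]] ez] := conn_nbr cRQ (x := e) (y := y).
    + by rewrite in_setD eQ.
    + by rewrite in_setD yQ.
    + by rewrite eq_sym.
    by exists z => //; apply/nbrP.
  by exists y => //; rewrite in_setD yQ.
have [->|/set0Pn [e1 /edgesP [x1 [y1 [xy1 _]]]]] := eqVneq (edges G) set0.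
  by exists [::]; [move=> g; rewrite in_set0|apply: greedy_ok_nil].
have d3 x : degree x = 3.
  have [y xy] : exists y, adj x y.
    have [->|xx1] := eqVneq x x1; first by exists y1.
    by have [|||y _ xy] := conn_nbr cG (x := x) (y := x1); rewrite ?inE //; exists y.
  apply: (nbr_gt3_degree xy); rewrite ltnNge; apply: contra noA => cg.
  by apply/exists_inP; exists [set x; y]; rewrite ?edges_adj.
have Wdg : {in [set: G], forall x, deg_in setT x = 3 - (x \in (set0 : {set G}))}.
  by move=> x _; rewrite deg_in_setT d3 inE.
have Wcut (M : {set G}) v : M \subset [set: G] :\: set0 -> M != set0 -> v \in setT :\: M ->
    (forall x y, x \in M -> y \in setT :\: M -> adj x y -> y = v) -> deg_in M v <= 1 -> False.
  move=> _ M0 vW bd dv.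
  have [||||e [e0 [eE e0E ve eM]]] :=
    @cut_component (edges G) setT M v cG E_E _ M0 vW bd dv.
  - exact: subsetT.
  - by move=> x _.
  - by move=> x y _ xy; rewrite inE edges_adj.
  - by [].
  (* A second edge at [v] lies outside [M], so removing [e] separates it from [e0], against
     [noA']. *)
  have vM : v \notin M by move: vW; rewrite inE => /andP [].
  have [x vx eE'] := edges_at eE ve.
  have [y /setDP [_]] : exists2 y, y \in setT :\: [set x] & adj v y.
    by apply: deg_in_nbr; rewrite cards1 deg_in_setT d3.
  rewrite in_set1 => yx vy; case/exists_inP: noA'; exists e => //.
  apply/exists_inP; exists e0 => //; apply/eqP => QE.
  have : [set v; y] \in edges G :\ e.
    rewrite in_setD1 edges_adj // andbT; apply/negP => /eqP/setP/(_ y).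
    by rewrite eE' !inE eqxx orbT (negPf yx) eq_sym (negPf (adj_neq vy)).
  rewrite -QE => /eM /subsetP /(_ v); rewrite !inE eqxx (negPf vM).
  by move/(_ isT).
have [|||a [b [l [w [[up pp pW wl aw] [_ cK chord [[ka kaK aka] [kb kbK bkb]] ends]]]]]] :=
  @exists_lollipop _ setT set0 cG _ _ _ Wdg Wcut.
- by apply/set0Pn; exists x1; rewrite inE.
- exact: sub0set.
- by rewrite cards0.
have [wE [kw kwK wkw]] := ends erefl.
(* As [kw] is off the cycle, [f] meets it only in [w]. Being first, [f] has colour 1, so the detour
   for colour 3 does not arise. *)
pose f := [set w; kw].
have fE : f \in edges G by apply: edges_adj.
have nf : ncol [::] f <= 1 by rewrite -[1]/(0.+1) -(@cards0 {set G}); apply: ncol_le_card.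
have of1 : greedy_ok [:: f].
  by rewrite -[[:: f]]/(rcons [::] f); apply: greedy_ok_rcons => //;
    [apply: greedy_ok_nil|apply: leq_trans nf _].
have cf1 : col [:: f] f <= 1 by rewrite -[[:: f]]/(rcons [::] f) col_rcons_new.
have [|||||||||||||||||||||||u uE ou] :=
  @extend_lollipop #|edges G| [:: f] (edges G :\ f) f w setT a b l w ka kb (@hanging _).
- by apply: leq_trans (leqnSn _); apply/subset_leq_card/subD1set.
- exact: of1.
- exact: subD1set.
- by move=> g /setD1P [gf _]; rewrite inE.
- by rewrite inE eqxx.
- exact: leq_trans cf1 _.
- by rewrite !inE eqxx.
- by [].
- move=> g x gE _ _; have [->|gf] := eqVneq g f; [by right|left].
  exact/setD1P.
- move=> x xp /set2P [] // xk; move: kwK; rewrite -xk !inE.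
  by move: xp; rewrite !inE => ->.
- exact: up.
- exact: pp.
- by [].
- exact: pW.
- exact: wl.
- exact: aw.
- exact: cK.
- exact: chord.
- exact: kaK.
- exact: aka.
- exact: kbK.
- exact: bkb.
- by move=> c3; rewrite c3 in cf1.
exists (f :: u) => // g; rewrite inE uE in_setD1.
by case: eqVneq => // ->.
Qed.

End Main.

Theorem theorem3 (G : sgraph) (hG : connected_graph G)
  (hdeg : max_degree G = 3) : connected_greedy_index hG <= 4.
Proof.
have subcubic (x : G) : degree x <= 3 by rewrite -hdeg; apply: (leq_bigmax x).
have [s sE os] := exists_greedy_ok subcubic hG.
exact: greedy_ok_connected_greedy_index os sE.
Qed.
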